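(* Any mass distribution $\mu$ in $\mathbb{R}^8$ can be equipartitioned in $7\times 2\times 2$ boxes by a collection of $6$ parallel hyperplanes and two additional non-parallel hyperplanes; that is, such hyperplanes exist for which each of the $28$ boxes they determine has $\mu$-measure $\frac{1}{28}\mu(\mathbb{R}^8)$.
   Context: A mass distribution in $\mathbb{R}^8$ is a finite Borel measure $\mu$ of the form $\mu(A)=\int_A f\,dx$ for an integrable density function $f:\mathbb{R}^8\to\mathbb{R}$ (integration with respect to Lebesgue measure), such that every nonempty open subset of $\mathbb{R}^8$ has positive $\mu$-measure. The two additional hyperplanes being non-parallel means that neither is parallel to the six parallel hyperplanes and that they are not parallel to each other. Boxes: the six parallel hyperplanes divide $\mathbb{R}^8$ into $7$ consecutive regions, and each additional hyperplane divides $\mathbb{R}^8$ into two half-spaces; the $7\times 2\times 2$ boxes are the intersections of one of the $7$ regions with one half-space of each of the two additional hyperplanes. *)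

(* Defs.v *)
From HB Require Import structures.
From mathcomp Require Import all_boot all_order all_algebra.
From mathcomp Require Import all_classical all_reals all_analysis.
From mathcomp Require Import measurable_realfun.

Set Implicit Arguments.
Unset Strict Implicit.
Unset Printing Implicit Defensive.

Import Order.TTheory GRing.Theory Num.Theory.
Import numFieldNormedType.Exports.

Local Open Scope classical_set_scope.
Local Open Scope ring_scope.

(* R^n is 'rV[R]_n, with the topology of the library; measurable sets of
   matrices are the Borel sets of that topology. *)
Section matrix_isMeasurable.
Context (R : realType) (m n : nat).
Let G := @open 'M[R]_(m, n).

HB.instance Definition _ := @isMeasurable.Build (sigma_display G)
  'M[R]_(m, n) <<s G >> (@sigma_algebra0 _ setT G) (@sigma_algebraC _ G)
  (@sigma_algebra_bigcup _ setT G).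

End matrix_isMeasurable.

Section borel_matrix.
Context (R : realType).

Lemma open_measurable_mx m n (U : set 'M[R]_(m, n)) : open U -> measurable U.
Proof. exact: sub_sigma_algebra. Qed.

Lemma measurable_coord m n (i : 'I_m) (j : 'I_n) :
  measurable_fun setT (fun M : 'M[R]_(m, n) => M i j).
Proof.
apply: (measurability _ (RGenOpens.measurableE R)) => _ [_ [a [b ->]] <-].
rewrite setTI; apply: open_measurable_mx; apply: open_comp.
  by move=> M _; exact: coord_continuous.
exact: interval_open.
Qed.

Lemma open_mx_rat_ball m n (U : set 'M[R]_(m, n)) : open U ->
  U = \bigcup_(q : 'M[rat]_(m, n) * nat)
    [set M | (ball (map_mx ratr q.1 : 'M[R]_(m, n)) q.2.+1%:R^-1
                `<=` U) /\
             forall i j, ball (ratr (q.1 i j) : R) q.2.+1%:R^-1 (M i j)].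
Proof.
move=> oU; apply/seteqP; split => [M UM|M [q _ /= [sU qM]]]; last first.
  apply: sU; split; first by rewrite invr_gt0.
  by move=> i j; rewrite mxE; exact: qM.
have /nbhs_ballP[e /= e0 eU] : nbhs M U by exact: open_nbhs_nbhs.
have e20 : 0 < e / 2 by rewrite divr_gt0.
have [k _ /(_ _ (leqnn k)) ke] := near_infty_natSinv_lt (PosNum e20).
have k0 : 0 < k.+1%:R^-1 :> R by rewrite invr_gt0.
have qP i j : {q : rat | ball (M i j) k.+1%:R^-1 (ratr q : R)}.
  apply/cid; have [|q] := @rat_in_itvoo R (M i j) (M i j + k.+1%:R^-1).
    by rewrite ltrDl.
  rewrite in_itv/= => /andP[Mq qM]; exists q.
  by rewrite /ball/= distrC gtr0_norm ?subr_gt0// ltrBlDl.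
exists (\matrix_(i, j) sval (qP i j), k) => //=; split; last first.
  by move=> i j; rewrite mxE; apply: ball_sym; exact: (svalP (qP i j)).
move=> N [_ qN]; apply: eU; split => // i j.
have := qN i j; rewrite !mxE => qNij.
apply: (@le_ball _ _ _ (k.+1%:R^-1 + k.+1%:R^-1)).
  by rewrite [e]splitr; apply: lerD; exact: ltW.
by apply: ball_triangle qNij; exact: (svalP (qP i j)).
Qed.

Lemma measurable_fun_mx d (T : measurableType d) m n (g : T -> 'M[R]_(m, n)) :
  (forall i j, measurable_fun setT (fun t => g t i j)) -> measurable_fun setT g.
Proof.
move=> mg; apply: (@measurability _ _ _ _ _ _ (@open 'M[R]_(m, n))) => //.
move=> _ [U oU <-]; rewrite setTI (open_mx_rat_ball oU) preimage_bigcup.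
apply: countable_bigcupT_measurable => // -[q k] /=.
set B := (X in X `<=` U).
have [BU|BU] := pselect (B `<=` U); last first.
  rewrite (_ : _ @^-1` _ = set0) ?measurable0//.
  by apply/seteqP; split => // t [].
rewrite (_ : _ @^-1` _ = \bigcap_(ij in [set: 'I_m * 'I_n])
  ((fun t => g t ij.1 ij.2) @^-1` ball (ratr (q ij.1 ij.2) : R) k.+1%:R^-1)).
  apply: fin_bigcap_measurable => // ij _.
  by rewrite -[X in measurable X]setTI; apply: mg => //; exact: measurable_ball.
apply/seteqP; split => [t [_ tB] ij _|t tB]; first exact: tB.
by split => // i j; exact: (tB (i, j)).
Qed.

End borel_matrix.

Section lebesgue_rV.
Context (R : realType).

Definition rV_cons n (p : 'rV[R]_n * measurableTypeR R) : 'rV[R]_n.+1 :=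
  row_mx (p.2%:M : 'rV_1) p.1.

Lemma rV_cons0 n (p : 'rV[R]_n * measurableTypeR R) : rV_cons p 0 ord0 = p.2.
Proof.
by have := row_mxEl (p.2%:M : 'rV_1) p.1 0 0; rewrite lshift0 => E;
  rewrite [LHS]E mxE eqxx.
Qed.

Lemma rV_consS n (p : 'rV[R]_n * measurableTypeR R) i :
  rV_cons p 0 (lift ord0 i) = p.1 0 i.
Proof.
by have := row_mxEr (p.2%:M : 'rV_1) p.1 0 i; rewrite rshift1.
Qed.

Lemma measurable_rV_cons n : measurable_fun setT (@rV_cons n).
Proof.
apply: measurable_fun_mx => i j; rewrite ord1 {i}.
have [k ->|->] := unliftP ord0 j.
  under eq_fun do rewrite rV_consS.
  exact: (measurableT_comp (measurable_coord _ k) measurable_fst).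
under eq_fun do rewrite rV_cons0.
exact: measurable_snd.
Qed.

(* Lebesgue measure on the Borel sets of R^n, as the n-fold product of the
   one-dimensional one. *)
Fixpoint lebesgue_rV n : set 'rV[R]_n -> \bar R :=
  match n with
  | 0 => \d_(0 : 'rV[R]_0)
  | n'.+1 =>
    pushforward (@lebesgue_rV n' \x @lebesgue_measure R)%E (@rV_cons n')
  end.

Let lebesgue_rV_measure n : {m : {measure set 'rV[R]_n -> \bar R} |
  m = @lebesgue_rV n :> (set 'rV[R]_n -> \bar R)}.
Proof.
elim: n => [|n [m mE]]; first by exists (\d_(0 : 'rV[R]_0)).
have mf := @measurable_rV_cons n.
pose p : {measure set ('rV[R]_n * measurableTypeR R) -> \bar R} :=
  (m \x @lebesgue_measure R)%E.
exists (measure_function_pushforward__canonical__measure_function_Measure p mf).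
by rewrite /= -mE.
Qed.

Let lebesgue_rV0 n : @lebesgue_rV n set0 = 0%E.
Proof. by have [m <-] := lebesgue_rV_measure n; exact: measure0. Qed.

Let lebesgue_rV_ge0 n A : (0 <= @lebesgue_rV n A)%E.
Proof. by have [m <-] := lebesgue_rV_measure n; exact: measure_ge0. Qed.

Let lebesgue_rV_sigma_additive n : semi_sigma_additive (@lebesgue_rV n).
Proof.
by have [m <-] := lebesgue_rV_measure n; exact: measure_semi_sigma_additive.
Qed.

HB.instance Definition _ n := isMeasure.Build _ _ _ (@lebesgue_rV n)
  (@lebesgue_rV0 n) (@lebesgue_rV_ge0 n) (@lebesgue_rV_sigma_additive n).

Lemma lebesgue_rV_box n (A : 'I_n -> set R) :
  (forall i, measurable (A i)) ->
  lebesgue_rV [set x : 'rV[R]_n | forall i, A i (x 0 i)] =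
  (\prod_(i < n) lebesgue_measure (A i))%E.
Proof.
elim: n A => [A _|n IH A mA].
  by rewrite big_ord0 /= diracE mem_set// => -[].
rewrite big_ord_recl muleC -IH => [|i]; last exact: mA.
pose B := [set x : 'rV[R]_n | forall i, A (lift ord0 i) (x 0 i)].
have mB : measurable B.
  rewrite (_ : B = \bigcap_(i in [set: 'I_n])
    ((fun x : 'rV[R]_n => x 0 i) @^-1` A (lift ord0 i))).
    apply: fin_bigcap_measurable => // i _.
    by rewrite -[X in measurable X]setTI; exact: (measurable_coord _ i).
  by apply/seteqP; split => x /= xA i; [move=> _|]; exact: xA.
have <- := product_measure1E (@lebesgue_rV n) (@lebesgue_measure R) mB (mA ord0).
congr product_measure1; apply/seteqP; split => [p /= pA|p /= [p1A p2A] i].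
  split=> [i|].
    by have := pA (lift ord0 i); rewrite rV_consS.
  by have := pA ord0; rewrite rV_cons0.
by have [j ->|->] := unliftP ord0 i; rewrite ?rV_consS ?rV_cons0//; exact: p1A.
Qed.

End lebesgue_rV.

(* A finite measure on R^n with a Lebesgue density that is positive on nonempty
   open sets. That f is nonnegative almost everywhere is not assumed: it follows
   from the nonnegativity of mu. *)
Definition mass_distribution (R : realType) (n : nat)
    (mu : {finite_measure set 'rV[R]_n -> \bar R}) : Prop :=
  (exists2 f : 'rV[R]_n -> R,
     (@lebesgue_rV R n).-integrable setT (EFin \o f) &
     forall A, measurable A ->
       mu A = (\int[@lebesgue_rV R n]_(x in A) (f x)%:E)%E) /\
  (forall U : set 'rV[R]_n, open U -> U !=set0 -> (0 < mu U)%E).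

(* The pair (u, b), u != 0, stands for the hyperplane {x | <u, x> = b}. *)
Section hyperplanes.
Context (R : realType) (n : nat).
Implicit Types (u v x : 'rV[R]_n) (b : R).

Definition dotr u x : R := \sum_i u 0 i * x 0 i.

(* Parallelism of the hyperplanes with nonzero normals u and v. *)
Definition parallel u v : Prop := exists k : R, v = k *: u.

(* Half-spaces and regions are closed; since hyperplanes are null for a measure
   with a Lebesgue density, this choice does not affect the measure of a box. *)
Definition halfspace u b (s : bool) : set 'rV[R]_n :=
  if s then [set x | b <= dotr u x] else [set x | dotr u x <= b].

(* For c increasing, the i-th of the k+1 consecutive closed regions bounded by
   the parallel hyperplanes (u, c j), j < k: the region between (u, c (i-1))
   and (u, c i), unbounded on one side for i = 0 and i = k. *)
Definition slab k u (c : 'I_k -> R) (i : 'I_k.+1) : set 'rV[R]_n :=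
  [set x | forall j : 'I_k, if (j < i)%N then c j <= dotr u x
                            else dotr u x <= c j].

End hyperplanes.

(* Main.v *)
(** Let [a] be a direction and cut space by the six hyperplanes normal to [a]
    into seven slabs of equal mass; they are unique and vary continuously with
    [a].  It remains to find hyperplanes [H1], [H2] such that, with [S1], [S2]
    the signs of their sides, the functions [S1], [S2] and [S1 * S2] have
    integral zero on each slab: 21 equations.  Take [a] in S^7, [H1] in the S^8
    of all affine hyperplanes (with the two at infinity) and [H2] in an S^6 of
    hyperplanes through the origin.  Replacing [a] by [- a] reverses the order
    of the slabs, so sums and differences of the equations of opposite slabs
    are odd or even in each of [a], [H1], [H2].  Writing x, y, z for the three
    antipodal actions, the equations are odd according to the linear forms in
    the product
      y^4 (y + x)^3 . z^4 (z + x)^3 . (y + z)^4 (y + z + x)^3,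
    in which x^7 y^8 z^6 has odd coefficient, so a Borsuk-Ulam argument gives a
    common zero.

    The Borsuk-Ulam argument is combinatorial.  A product of three projective
    spaces is a cube of dimension 7 + 8 + 6 with antipodal points of the
    boundary identified block by block.  Subdivide it into a cubical grid, and
    let a sign function be attached to each equation.  The number, modulo 2, of
    maximal flags of cells in which the j-th step changes the j-th sign does not
    change when the first sign function is replaced by another one with the same
    antipodal behaviour, in particular by the side of a coordinate hyperplane;
    the flags then live in that hyperplane and induction on the dimension
    computes the number.  Fine subdivisions and compactness give the zero. *)

Require Import Defs.
From HB Require Import structures.
From mathcomp Require Import all_boot zify.

Set Implicit Arguments.
Unset Strict Implicit.
Unset Printing Implicit Defensive.

(** * Parity of alternating flags in a subdivided cube *)

Local Notation "\xor_ ( i | P ) F" := (\big[addb/false]_(i | P) F)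
  (at level 41, F at level 41, i, P at level 50).
Local Notation "\xor_ ( i : T ) F" := (\big[addb/false]_(i : T) F)
  (at level 41, F at level 41, i, T at level 50).
Local Notation "\xor_ i F" := (\big[addb/false]_i F)
  (at level 41, F at level 41, i at level 0).

Section Cells.
Variables (n M : nat).

(* Coordinate by coordinate, an even value is a vertex and an odd value an open
   edge of a subdivision of a segment into M pieces: the elements are all the
   cells of the cubical grid with M^n top cells.  A step replaces a vertex by an
   adjacent edge, hence passes to a coface of dimension one more. *)
Definition cell := {ffun 'I_n -> 'I_M.*2.+1}.
Implicit Types (z : cell) (i : 'I_n) (d e : bool).

Definition can_step z (x : 'I_n * bool) :=
  ~~ odd (z x.1) && (if x.2 then z x.1 < M.*2 else 0 < z x.1).

Definition step z (x : 'I_n * bool) : cell :=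
  [ffun k => if k == x.1 then inord (if x.2 then (z k).+1 else (z k).-1)
             else z k].

Lemma step_eq z x : can_step z x ->
  step z x x.1 = (if x.2 then (z x.1).+1 else (z x.1).-1) :> nat.
Proof.
case/andP=> _ h; rewrite ffunE eqxx inordK //.
by case: x.2 h => /= h; have := ltn_ord (z x.1); lia.
Qed.

Lemma step_neq z x k : k != x.1 -> step z x k = z k.
Proof. by move=> kx; rewrite ffunE (negPf kx). Qed.

(** A step makes its coordinate odd and only even coordinates can step, so consecutive steps move
    different coordinates and commute. *)
Lemma can_stepC z x y : can_step z x -> can_step (step z x) y ->
  [/\ x.1 != y.1, can_step z y, can_step (step z y) x &
      step (step z x) y = step (step z y) x].
Proof.
move=> zx zxy.
have xy : x.1 != y.1.
  apply/negP=> /eqP xy; move: zxy.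
  rewrite /can_step -xy step_eq // => /andP[+ _].
  move: zx => /andP[]; case: x.2 => /=; lia.
have zy : can_step z y by move: zxy; rewrite /can_step step_neq // eq_sym.
split=> //; first by rewrite /can_step step_neq.
apply/ffunP=> k; rewrite !ffunE.
case: (eqVneq k y.1) => [->|//]; first by rewrite eq_sym (negPf xy).
Qed.

Lemma xor_sym0 (T : finType) (S : T -> T -> bool) :
  (forall x, S x x = false) -> (forall x y, S x y = S y x) ->
  \xor_ x \xor_ y S x y = false.
Proof.
move=> S0 SC; have swap_inj : injective (fun p : T * T => (p.2, p.1)).
  by apply: can_inj (fun p => (p.2, p.1)) _; case.
rewrite pair_big /=.
rewrite (bigID (fun p => enum_rank p.1 < enum_rank p.2)) /=.
rewrite [X in _ (+) X](bigID (fun p => enum_rank p.2 < enum_rank p.1)) /=.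
rewrite [X in _ (+) (_ (+) X)]big1 => [|[x y] /= /andP[]]; last first.
  rewrite -!leqNgt => h1 h2.
  have -> : x = y by apply: enum_rank_inj; apply: val_inj => /=; lia.
  by rewrite S0.
rewrite addbF [X in _ (+) X](reindex_inj swap_inj) /=.
rewrite [X in _ (+) X](eq_big (fun p => enum_rank p.1 < enum_rank p.2)
  (fun p => S p.1 p.2)) ?addbb // => -[x y] /=.
by apply/andP/idP => [[]|h2] //; split=> //; rewrite -leqNgt ltnW.
Qed.

(* Parity of the number of flags z < z1 < ... < zk, each a facet of the next,
   along which the j-th step changes the value of the j-th function, and whose
   last cell satisfies t. *)
Fixpoint flips (t : cell -> bool) (ss : seq (cell -> bool)) z : bool :=
  if ss is s :: ss' then
    \xor_(x | can_step z x) ((s z (+) s (step z x)) && flips t ss' (step z x))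
  else t z.

Definition end_pt e : nat := if e then M.*2 else 0.
Definition at_end i e z := z i == end_pt e :> nat.

(** Per coordinate, for M > 0: an odd value allows no step, an inner vertex two, an end vertex
    one. *)
Lemma xor_cover z :
  \xor_(x | can_step z x) true = \xor_(y : 'I_n * bool) at_end y.1 y.2 z.
Proof.
rewrite big_mkcond /= -(pair_big xpredT xpredT
  (fun i e => if can_step z (i, e) then true else false)) /=.
rewrite -(pair_big xpredT xpredT (fun i e => at_end i e z)) /=.
apply: eq_bigr => i _; rewrite !big_bool /at_end /can_step /=.
have := ltn_ord (z i); rewrite /end_pt ltnS leq_eqVlt.
case: (boolP (odd _)) => /= oz zM.
  have -> : (z i == M.*2 :> nat) = false by apply/negP; lia.
  by have -> : (z i == 0 :> nat) = false by apply/negP; lia.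
by case: (ltngtP (z i) M.*2) zM; case: (ltngtP 0 (z i)) => //=; lia.
Qed.

(* Two steps can be made in either order, so in the sum over the first two steps
   the terms that ignore the middle cell cancel; only the flags ending on the
   boundary of the cube survive. *)
Lemma flips_boundary ss z :
  \xor_(x | can_step z x) flips xpredT ss (step z x) =
  \xor_(y : 'I_n * bool) flips (at_end y.1 y.2) ss z.
Proof.
elim: ss z => [|s ss IH] z; first exact: xor_cover.
pose S x y := [&& can_step z x, can_step (step z x) y,
  s (step (step z x) y) & flips xpredT ss (step (step z x) y)].
pose U x y := [&& can_step z x, can_step (step z x) y,
  s z & flips xpredT ss (step (step z x) y)].
have sym0 (V : 'I_n * bool -> 'I_n * bool -> bool) :
    (forall x y, V x y -> can_step z x && can_step (step z x) y) ->
    (forall x y, can_step z x -> can_step (step z x) y ->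
        V x y = V y x) -> \xor_ x \xor_ y V x y = false.
  move=> VP VC; apply: xor_sym0 => [x|x y].
    by apply/negP=> /VP/andP[h1 h2]; case: (can_stepC h1 h2); rewrite eqxx.
  apply/idP/idP => Vxy; have /andP[h1 h2] := VP _ _ Vxy.
    by rewrite -VC.
  by rewrite -VC.
have S0 : \xor_ x \xor_ y S x y = false.
  apply: sym0 => [x y /and4P[-> ->] //|x y h1 h2].
  by case: (can_stepC h1 h2) => _ h3 h4 e; rewrite /S h1 h2 h3 h4 e.
have U0 : \xor_ x \xor_ y U x y = false.
  apply: sym0 => [x y /and4P[-> ->] //|x y h1 h2].
  by case: (can_stepC h1 h2) => _ h3 h4 e; rewrite /U h1 h2 h3 h4 e.
(* Adding the vanishing sums of [S] and [U] moves the required sign change from the second step to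
   the first, so that the induction hypothesis applies to the inner sum. *)
have -> : \xor_(x | can_step z x) flips xpredT (s :: ss) (step z x) =
    \xor_(x | can_step z x) ((s z (+) s (step z x)) &&
      \xor_(y | can_step (step z x) y) flips xpredT ss (step (step z x) y)).
  transitivity (\xor_(x | can_step z x) flips xpredT (s :: ss) (step z x)
     (+) (\xor_ x \xor_ y S x y (+) \xor_ x \xor_ y U x y)).
    by rewrite S0 U0 !addbF.
  rewrite big_mkcond [RHS]big_mkcond -!big_split /=.
  apply: eq_bigr => x _; case: ifP => zx; last first.
    have -> : \xor_ y S x y = false by apply: big1 => y _; rewrite /S zx.
    by have -> : \xor_ y U x y = false by apply: big1 => y _; rewrite /U zx.
  rewrite big_distrr /= big_mkcond [RHS]big_mkcond -!big_split /=.
  apply: eq_bigr => y _; rewrite /S /U zx; case: ifP => //= _.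
  by case: (s z); case: (s _); case: (s _); case: (flips _ _ _).
under eq_bigr => x _ do rewrite IH big_distrr.
by rewrite exchange_big.
Qed.

Lemma at_end_step i e z x :
  can_step z x -> at_end i e (step z x) -> i != x.1 /\ at_end i e z.
Proof.
move=> zx; case: (eqVneq i x.1) => [->|ix]; last by rewrite /at_end step_neq.
rewrite /at_end step_eq //; move: zx => /andP[]; rewrite /end_pt.
by case: e; case: x.2 => /=; lia.
Qed.

(** Lying in a face of the cube passes down a flag, from its last cell to its first. *)
Lemma flips_at_end i e ss z : flips (at_end i e) ss z -> at_end i e z.
Proof.
elim: ss z => [//|s ss IH] z /=; apply: contraTT => zie.
rewrite big1 // => x zx; apply/negP => /andP[_ /IH /(at_end_step zx)[_]].
exact/negP.
Qed.

(* The vertices of the subcube whose coordinates outside A are frozen at the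
   middle edge M. *)
Definition base (A : {set 'I_n}) z :=
  [forall k, if k \in A then ~~ odd (z k) else z k == M :> nat].

Lemma step_val z i d : step z (i, d) i = (if d then
  if z i < M.*2 then (z i).+1 else 0 else (z i).-1) :> nat.
Proof.
rewrite ffunE eqxx /=; have := ltn_ord (z i); case: d => h.
  case: ifP => hz; first by rewrite inordK.
  by rewrite /inord /insubd insubN // ltnS hz.
by rewrite inordK //; lia.
Qed.

Lemma stepK z i d : can_step z (i, d) -> step (step z (i, d)) (i, ~~ d) = z.
Proof.
rewrite /can_step => /andP[/= oz zc]; have zM := ltn_ord (z i).
apply/ffunP=> k; apply: val_inj => /=.
case: (eqVneq k i) => [->|ki]; last by rewrite !step_neq.
rewrite (step_val _ i (~~ d)) (step_val _ i d) /=.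
by move: zc; case: d => /=; do ?case: ifP; lia.
Qed.

(** The middle value is then an edge: a coordinate frozen there admits no step. *)
Hypothesis M_odd : odd M.

Lemma step_oddK z i d : odd (z i) -> step (step z (i, ~~ d)) (i, d) = z.
Proof.
move=> zi; apply/ffunP=> k; apply: val_inj; have zM := ltn_ord (z i).
case: (eqVneq k i) => [->|ki]; last by rewrite !step_neq.
rewrite /= (step_val _ i d) (step_val _ i (~~ d)) /=.
by case: d => /=; do ?case: ifP; lia.
Qed.

(** Every edge of the subcube is reached from both of its ends, so its two contributions cancel. *)
Lemma xor_facets (A : {set 'I_n}) (f : cell -> bool) :
  \xor_(z | base A z) \xor_(x | can_step z x) f (step z x) = false.
Proof.
have can2 z i d : odd (z i) -> can_step (step z (i, ~~ d)) (i, d).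
  move=> zi; have zM := ltn_ord (z i); rewrite /can_step (step_val _ i (~~ d)) /=.
  by case: d => /=; do ?case: ifP; lia.
(* The cell z is an edge of the subcube in direction i. The upper end is singled out, but by [QE]
   either end gives the same condition. *)
pose Q i z := odd (z i) && base A (step z (i, true)).
have QE i (d : bool) z : [&& base A (step z (i, ~~ d)),
    can_step (step z (i, ~~ d)) (i, d) &
    step (step z (i, ~~ d)) (i, d) == z] = Q i z.
  have zi := ltn_ord (z i); rewrite /Q; case: (boolP (odd (z i))) => oz /=.
    rewrite can2 // step_oddK // eqxx !andbT; apply: eq_forallb => k.
    case: (eqVneq k i) => [->|ki]; last by rewrite !step_neq.
    rewrite !step_val; case: d => /=; do ?case: ifP; lia.
  apply/negP => /and3P[_]; rewrite /can_step (step_val _ i (~~ d)) /=.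
  case: d => /=; last by case: ifP => //; lia.
  move=> /andP[z0 _] /eqP /(congr1 (fun w : cell => w i : nat)).
  by rewrite (step_val _ i true) (step_val _ i false) /=; case: ifP; lia.
transitivity (\xor_(i : 'I_n) \xor_(d : bool)
    \xor_(z | base A z && can_step z (i, d)) f (step z (i, d))).
  rewrite pair_big /= (exchange_big_dep xpredT) //=; apply: eq_bigr => -[i d] _.
apply: big1 => i _; rewrite big_bool /=.
have half (d : bool) : \xor_(z | base A z && can_step z (i, d)) f (step z (i, d)) =
    \xor_(z | Q i z) f z.
  rewrite (reindex_onto (fun z => step z (i, ~~ d)) (fun z => step z (i, d))) /=.
    under eq_bigl do rewrite -andbA QE.
    by apply: eq_bigr => z /andP[zi _]; rewrite step_oddK.
  move=> z /andP[_ zc]; exact: stepK.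
by rewrite !half addbb.
Qed.

(** * Antipodal symmetry on the boundary of each block *)

Variables (T : finType) (blk : 'I_n -> T).

Definition antipode b z : cell :=
  [ffun k => if blk k == b then rev_ord (z k) else z k].

Definition on_boundary b z := [exists i, (blk i == b) && [exists e, at_end i e z]].

(** Only antipodal points of the boundary of a block are identified, so the symmetry is required
    there alone; [chi b] tells whether [s] is odd in block b. *)
Definition antisym (chi : T -> bool) (s : cell -> bool) :=
  forall b z, on_boundary b z -> s (antipode b z) = s z (+) chi b.

Lemma antipodeK b : involutive (antipode b).
Proof.
move=> z; apply/ffunP=> k; rewrite !ffunE.
by case: (blk k == b) => //; exact: rev_ordK.
Qed.

Lemma antipode_step b z x : can_step z x ->
  let y := (x.1, if blk x.1 == b then ~~ x.2 else x.2) in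
  can_step (antipode b z) y /\ step (antipode b z) y = antipode b (step z x).
Proof.
case: x => i d zx /=; have zM := ltn_ord (z i).
have c : can_step (antipode b z) (i, if blk i == b then ~~ d else d).
  move: zx; rewrite /can_step /= !ffunE; case: (blk i == b) => //=.
  by case: d => /=; lia.
split=> //; apply/ffunP=> k; apply: val_inj => /=.
case: (eqVneq k i) => [->|ki]; last first.
  by rewrite step_neq // !ffunE /= (negPf ki).
rewrite step_val [antipode b z i]ffunE [antipode b (step z (i, d)) i]ffunE.
have e := step_val z i d; move: e zx; rewrite /can_step /=.
by case: (blk i == b); case: d {c} => /= e; rewrite e; do ?case: ifP => //; lia.
Qed.

Lemma at_end_antipode i e z : at_end i e (antipode (blk i) z) = at_end i (~~ e) z.
Proof.
rewrite /at_end ffunE eqxx /= /end_pt; have := ltn_ord (z i).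
by case: e => /=; lia.
Qed.

Lemma at_end_boundary i e z : at_end i e z -> on_boundary (blk i) z.
Proof.
by move=> h; apply/existsP; exists i; rewrite eqxx; apply/existsP; exists e.
Qed.

Variables (J : Type) (chi : J -> T -> bool) (sg : J -> cell -> bool).
Hypothesis sg_antisym : forall j, antisym (chi j) (sg j).

(** The antipode carries flags of a face to flags of the opposite face; the two signs compared at a
    step change by the same bit [chi j b]. *)
Lemma flips_antipode i e js z :
  flips (at_end i e) (map sg js) (antipode (blk i) z) =
  flips (at_end i (~~ e)) (map sg js) z.
Proof.
elim: js z => [|j js IH] z /=; first exact: at_end_antipode.
set b := blk i.
pose h (x : 'I_n * bool) := (x.1, if blk x.1 == b then ~~ x.2 else x.2).
have hK : involutive h.
  by case=> k d; rewrite /h /=; case: (blk k == b); rewrite /= ?negbK.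
rewrite (reindex_inj (inv_inj hK)); apply: eq_big => [x|x].
  apply/idP/idP => zx; last by have [] := antipode_step b zx.
  by have [] := antipode_step b zx; rewrite -/(h _) hK antipodeK.
move=> zx'; have zx : can_step z x.
  by have [] := antipode_step b zx'; rewrite -/(h _) hK antipodeK.
have [_ ->] := antipode_step b zx; rewrite IH.
case: (boolP (flips _ _ _)) => [/flips_at_end ex|_]; last by rewrite !andbF.
have [ix ez] := at_end_step zx ex.
rewrite !(sg_antisym _ (at_end_boundary ex)) (sg_antisym _ (at_end_boundary ez)).
by case: (chi j b); case: (sg j z); case: (sg j _).
Qed.

Definition sum_flips (A : {set 'I_n}) ss := \xor_(z | base A z) flips xpredT ss z.

Definition next_flips ss z := \xor_(x | can_step z x) flips xpredT ss (step z x).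

Lemma base_antipode A b z : base A (antipode b z) = base A z.
Proof.
apply: eq_forallb => k; rewrite ffunE; have := ltn_ord (z k).
by case: (blk k == b); case: (k \in A) => //=; lia.
Qed.

(* A function h invariant under the antipodal identifications does not contribute:
   the boundary terms of opposite faces agree. *)
Lemma xor_symmetric A h js :
  (forall b z, base A z -> on_boundary b z -> h (antipode b z) = h z) ->
  \xor_(z | base A z) (h z && next_flips (map sg js) z) = false.
Proof.
move=> hsym.
under eq_bigr => z _ do rewrite /next_flips flips_boundary big_distrr /=.
rewrite exchange_big /= -(pair_big xpredT xpredT (fun i e =>
  \xor_(z | base A z) (h z && flips (at_end i e) (map sg js) z))) /=.
apply: big1 => i _; rewrite big_bool /=.
rewrite [X in _ (+) X](reindex_inj (inv_inj (antipodeK (blk i)))) /=.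
rewrite [X in _ (+) X](eq_big (base A)
  (fun z => h z && flips (at_end i true) (map sg js) z)) ?addbb //.
  by move=> z; rewrite base_antipode.
move=> z; rewrite base_antipode => zA; rewrite flips_antipode /=.
case: (boolP (flips _ _ _)) => [/flips_at_end ez|_]; last by rewrite !andbF.
by rewrite hsym //; exact: at_end_boundary ez.
Qed.

(* The values of s on edges are irrelevant, since every edge has two ends. *)
Lemma sum_flips_cons A s ss :
  sum_flips A (s :: ss) = \xor_(z | base A z) (s z && next_flips ss z).
Proof.
have := xor_facets A (fun z => s z && flips xpredT ss z).
move=> /(congr1 (addb (\xor_(z | base A z) (s z && next_flips ss z)))).
rewrite addbF => <-; rewrite -big_split /=.
apply: eq_bigr => z _; rewrite big_distrr -big_split /=; apply: eq_bigr => x _.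
by case: (s z); case: (s _); case: (flips _ _ _).
Qed.

(* The first step must be the one from M + 1 down to M in direction i. *)
Lemma sum_flips_peel (A : {set 'I_n}) i ss : i \in A ->
  \xor_(z | base A z) ((M < z i) && next_flips ss z) = sum_flips (A :\ i) ss.
Proof.
move=> iA; rewrite -(sum_flips_cons A (fun z => M < z i)) /sum_flips /=.
have M0 : 0 < M by case: (M) M_odd.
transitivity (\xor_(z | base A z && (z i == M.+1 :> nat))
    flips xpredT ss (step z (i, false))).
  rewrite big_mkcondr /=; apply: eq_bigr => z zA; case: eqP => zi.
    rewrite (bigD1 (i, false)) /=; last first.
      by rewrite /can_step /= zi /= M_odd.
    rewrite step_val zi ltnS leqnn ltnn /= big1 ?addbF // => -[k d] /andP[zk].
    rewrite -/(can_step z (k, d)); case: (eqVneq k i) zk => [->|ki] zk ne; last first.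
      by rewrite step_neq 1?eq_sym // zi ltnSn.
    rewrite step_val; case: d zk ne => zk ne; last by rewrite eqxx in ne.
    move: zk; rewrite /can_step /= zi => /andP[_ h].
    by rewrite h ltnS leqnSn.
  apply: big1 => -[k d] zk; case: (eqVneq k i) => ki; last first.
    by rewrite step_neq 1?eq_sym // addbb.
  move: zk; rewrite ki {k ki} step_val /can_step /= => /andP[oz].
  by case: d => [->|]; case: ltngtP; case: ltngtP; lia.
(* Lowering coordinate i from M + 1 to the edge M turns these vertices into the vertices of the
   subcube of [A :\ i]. *)
rewrite (reindex_onto (fun z => step z (i, true)) (fun z => step z (i, false))) /=.
  apply: eq_big => [z|z]; last by move=> /andP[_ /eqP ->].
  apply/idP/idP => [/andP[/andP[/forallP zA /eqP zi] /eqP zz]|/forallP zA].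
    apply/forallP => k; rewrite !inE; case: (eqVneq k i) => [->|ki] /=.
      by rewrite -zz step_val zi.
    by have := zA k; rewrite step_neq.
  have /eqP zi : z i == M :> nat by have := zA i; rewrite !inE eqxx.
  rewrite (@step_oddK z i false) ?zi // eqxx step_val zi.
  have -> : M < M.*2 by lia.
  rewrite eqxx !andbT; apply/forallP => k; have := zA k; rewrite !inE.
  case: (eqVneq k i) => [->|ki] /=; last by rewrite step_neq.
  by rewrite iA step_val zi; case: ifP => //= _ _; rewrite M_odd.
move=> z /andP[_ /eqP zi]; apply: (@stepK z i false).
by rewrite /can_step /= zi /= M_odd.
Qed.

(* The coefficient modulo 2 of \prod_b x_b ^ c b in the product of the linear
   forms \sum_b ch b * x_b, for a list of length \sum_b c b. *)
Fixpoint coef (chis : seq (T -> bool)) (c : T -> nat) : bool :=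
  if chis is ch :: chis' then
    \xor_(b : T) [&& ch b, 0 < c b & coef chis' (fun b' => c b' - (b' == b))]
  else true.

(** By [xor_symmetric], [sg j] may be replaced by a sum of coordinate half-spaces, one for each
    block in which it is odd; each of them peels off one coordinate of its block, as one factor of
    the monomial. *)
Lemma sum_flips_coef (js : seq J) (A : {set 'I_n}) (c : T -> nat) :
  (forall b, c b = #|[set i in A | blk i == b]|) -> size js = #|A| ->
  sum_flips A (map sg js) = coef (map chi js) c.
Proof.
elim: js A c => [|j js IH] A c cA szA.
  have A0 : A = set0 by apply/eqP; rewrite -cards_eq0 -szA.
  rewrite /sum_flips /= (big_pred1 [ffun=> inord M]) // => z.
  apply/forallP/eqP => [zA|-> k].
    apply/ffunP => k; apply: val_inj; rewrite ffunE /= inordK; last by lia.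
    by have := zA k; rewrite A0 inE => /eqP.
  by rewrite A0 inE ffunE /= inordK //; lia.
rewrite [LHS]sum_flips_cons.
(* One free coordinate per block; if there is none, [c b] is 0 and the block contributes nothing on
   either side. *)
pose rep b := [pick i | (i \in A) && (blk i == b)].
pose sig b (z : cell) := if rep b is Some i then M < z i else false.
pose h z := sg j z (+) \xor_(b : T) (chi j b && sig b z).
have hsym b z : base A z -> on_boundary b z -> h (antipode b z) = h z.
  move=> zA zb; have := zb => /existsP[i /andP[/eqP ib /existsP[e ie]]].
  have iA : i \in A.
    move/forallP: zA => /(_ i); case: (i \in A) => // /eqP zi.
    move: ie; rewrite /at_end zi /end_pt; have : 0 < M by case: (M) M_odd.
    by case: e; lia.
  rewrite /h (sg_antisym j zb) -!addbA; congr addb.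
  rewrite (bigD1 b) //= [in RHS](bigD1 b) //= addbA; congr addb; last first.
    apply: eq_bigr => b' bb'; rewrite /sig /rep; case: pickP => // k /andP[_ /eqP kb].
    by rewrite ffunE kb (negPf bb').
  rewrite /sig /rep; case: pickP => [k /andP[kA /eqP kb]|/(_ i)]; last first.
    by rewrite iA ib eqxx.
  move/forallP: zA => /(_ k); rewrite kA ffunE kb eqxx => zk.
  case: (chi j b) => //=; have := ltn_ord (z k); move: M_odd zk.
  by case: ltngtP; case: ltngtP; lia.
have := xor_symmetric js hsym.
rewrite (eq_bigr (fun z => (sg j z && next_flips (map sg js) z) (+)
  \xor_(b : T) (chi j b && (sig b z && next_flips (map sg js) z)))); last first.
  move=> z _; rewrite /h andb_addl; congr addb; rewrite big_distrl /=.
  by apply: eq_bigr => b _; rewrite andbA.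
rewrite big_split /= => /(congr1 (addb^~ (\xor_(z | base A z)
  \xor_(b : T) (chi j b && (sig b z && next_flips (map sg js) z))))).
rewrite -addbA addbb addbF => ->; rewrite addFb exchange_big /=.
apply: eq_bigr => b _; rewrite -big_distrr /=; congr andb.
rewrite /sig /rep; case: pickP => [i /andP[iA /eqP ib]|none]; last first.
  rewrite big1 // cA card_gt0; apply/esym/negP => /andP[/set0Pn[i] + _].
  by rewrite inE none.
have cE b' : c b' = ((b' == b) + #|[set k in A :\ i | blk k == b']|)%N.
  rewrite cA (cardsD1 i) inE iA ib eq_sym; congr addn.
  by apply: eq_card => k; rewrite !inE andbA.
rewrite sum_flips_peel // cE eqxx /=; apply: IH => [b'|].
  by rewrite cE addKn.
by move: szA; rewrite (cardsD1 i) iA => -[].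
Qed.

(** * From an odd number of flags to one small cell *)

Definition touching z z' := [forall k, (z k - z' k <= 1) && (z' k - z k <= 1)].

(** The face relation: each even coordinate may become an adjacent odd one. *)
Definition reach z z' := [forall k, (z' k == z k) ||
  [&& ~~ odd (z k), odd (z' k), z k - z' k <= 1 & z' k - z k <= 1]].

Lemma reach_refl z : reach z z.
Proof. by apply/forallP => k; rewrite eqxx. Qed.

Lemma reach_trans : transitive reach.
Proof.
move=> y x z /forallP xy /forallP yz; apply/forallP => k.
have := xy k; have := yz k; case: eqP => [->//|_] /=.
by case/and4P => o1 o2 ? ?; case: eqP => [<-|_] /=; [rewrite o1 o2; lia|lia].
Qed.

Lemma reach_step z x : can_step z x -> reach z (step z x).
Proof.
case: x => i d zx; apply/forallP => k; case: (eqVneq k i) => [->|ki].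
  apply/orP; right; move: zx; rewrite step_val /can_step /=.
  by case: d => /andP[/= oz h]; rewrite ?h; lia.
by rewrite step_neq // eqxx.
Qed.

Lemma reach_touching z z' : reach z z' -> touching z z'.
Proof.
move=> /forallP zz; apply/forallP => k; have := zz k.
by case: eqP => [->|_ /and4P[_ _ -> ->] //]; rewrite subnn.
Qed.

(** An odd sum has a nonzero term at every level, which yields a flag; all its cells have z as a
    face. *)
Lemma flips_witness t ss z : flips t ss z -> forall j, j < size ss ->
  exists z1 z2, [/\ touching z z1, touching z z2 &
    nth xpredT ss j z1 (+) nth xpredT ss j z2].
Proof.
move=> zs; suff W j : j < size ss -> exists z1 z2, [/\ reach z z1, reach z z2 &
    nth xpredT ss j z1 (+) nth xpredT ss j z2].
  by move=> j /W[z1 [z2 [? ? ?]]]; exists z1, z2; split=> //; exact: reach_touching.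
elim: ss z zs j => [//|s ss IH] z /= zs j jss.
have [x zx /andP[zsx fx]] : exists2 x, can_step z x &
    (s z (+) s (step z x)) && flips t ss (step z x).
  apply/exists_inP; apply: contraTT zs => /exists_inPn none.
  by rewrite big1 // => x /none /negPf.
case: j jss => [|j] jss /=.
  by exists z, (step z x); rewrite reach_refl reach_step.
have [z1 [z2 [r1 r2 ss12]]] := IH _ fx j jss.
by exists z1, z2; split=> //; apply: reach_trans (reach_step zx) _.
Qed.

(** For each block with [ch b], [pick] selects a coordinate at an end, the same for antipodal cells;
    recording which end it is gives an odd function. *)
Lemma antisym_exists (ch : T -> bool) : exists s, antisym ch s.
Proof.
pose p b (z : cell) i := (blk i == b) && [exists e, at_end i e z].
exists (fun z => \xor_(b : T)
  (ch b && if [pick i | p b z i] is Some i then at_end i true z else false)).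
move=> b z zb; rewrite (bigD1 b) //= [in RHS](bigD1 b) //= [RHS]addbAC.
have pE b' i : p b' (antipode b z) i = p b' z i.
  rewrite /p; case: eqP => //= _; apply/existsP/existsP => -[e ie].
    case: (eqVneq (blk i) b) ie => [<-|ib].
      by rewrite at_end_antipode; exists (~~ e).
    by rewrite /at_end ffunE (negPf ib); exists e.
  case: (eqVneq (blk i) b) => [<-|ib]; last by exists e; rewrite /at_end ffunE (negPf ib).
  by exists (~~ e); rewrite at_end_antipode negbK.
congr addb; last first.
  apply: eq_bigr => b' bb'; rewrite (eq_pick (pE b')).
  case: pickP => // i /andP[/eqP ib _].
  by rewrite /at_end ffunE ib (negPf bb').
rewrite (eq_pick (pE b)); case: pickP => [i /andP[/eqP ib /existsP[e ie]]|none].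
  subst b; rewrite at_end_antipode /=; case: (ch _) => //=.
  rewrite addbT; move: ie; rewrite /at_end /end_pt; have : 0 < M by case: (M) M_odd.
  by case: e => M0 /eqP ->; lia.
by case/existsP: zb => i; have := none i; rewrite /p => ->.
Qed.

Theorem antisym_touching_flips (js : seq J) :
  size js = n -> coef (map chi js) (fun b => #|[set i | blk i == b]|) ->
  exists z, forall j, j < size js -> exists z1 z2,
    [/\ touching z z1, touching z z2 &
        nth xpredT (map sg js) j z1 (+) nth xpredT (map sg js) j z2].
Proof.
move=> szn cf; have : sum_flips setT (map sg js).
  rewrite (@sum_flips_coef js setT (fun b => #|[set i | blk i == b]|)) //.
    by move=> b; apply: eq_card => i; rewrite !inE.
  by rewrite cardsT card_ord.
case: (pickP (fun z => flips xpredT (map sg js) z)) => [z zs _|none].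
  by exists z => j jn; apply: flips_witness zs _ _; rewrite size_map.
by rewrite /sum_flips big1 // => z _; rewrite none.
Qed.
End Cells.

(** * The parities of the 21 equations and their coefficient *)

(* Dimensions 7, 8 and 6: the direction of the slabs and the two other cuts. *)
Definition block (i : nat) : nat := if i < 7 then 0 else if i < 15 then 1 else 2.

Lemma block_lt i : block i < 3. Proof. by rewrite /block; do 2?case: ifP. Qed.

Definition blk (i : 'I_21) : 'I_3 := Ordinal (block_lt i).

(* The parity in block b of the j-th equation, for j = 7 g + e: g tells the cuts
   involved (first, second, both), and e < 4 the combinations of opposite slabs
   that are even in the direction of the slabs. *)
Definition charN (j b : nat) : bool :=
  match b with
  | 0 => 4 <= j %% 7
  | 1 => j %/ 7 != 1
  | _ => j %/ 7 != 0
  end.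

Arguments charN : simpl never.

Definition char (j : 'I_21) (b : 'I_3) := charN j b.

(** Plain numbers as exponents, in place of a function, let [coef] be evaluated by computation. *)
Fixpoint coef3 (js : seq nat) (p q r : nat) : bool :=
  if js is j :: js' then
    (if charN j 0 && (0 < p) then coef3 js' p.-1 q r else false) (+)
    ((if charN j 1 && (0 < q) then coef3 js' p q.-1 r else false) (+)
     (if charN j 2 && (0 < r) then coef3 js' p q r.-1 else false))
  else true.

Lemma eq_coef (T : finType) (l : seq (T -> bool)) c d :
  c =1 d -> coef l c = coef l d.
Proof.
elim: l c d => [//|ch l IH] c d cd /=; apply: eq_bigr => b _; rewrite cd.
by congr [&& _, _ & _]; apply: IH => b'; rewrite cd.
Qed.

Lemma coef_coef3 (js : seq nat) p q r :
  coef [seq (fun b : 'I_3 => charN j b) | j <- js] (fun b =>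
    nth 0 [:: p; q; r] b) =
  coef3 js p q r.
Proof.
elim: js p q r => [//|j js IH] p q r /=.
rewrite !big_ord_recl big_ord0 addbF /=; congr (_ (+) (_ (+) _)).
- case: (charN j 0) => //=; case: p => //= p; rewrite -IH.
  by apply: eq_coef => -[[|[|[|//]]] h] /=; lia.
- case: (charN j 1) => //=; case: q => //= q; rewrite -IH.
  by apply: eq_coef => -[[|[|[|//]]] h] /=; lia.
- case: (charN j 2) => //=; case: r => //= r; rewrite -IH.
  by apply: eq_coef => -[[|[|[|//]]] h] /=; lia.
Qed.

Lemma char_coef :
  coef [seq char j | j <- enum 'I_21] (fun b => #|[pred i | blk i == b]|).
Proof.
have -> : [seq char j | j <- enum 'I_21] =
    [seq (fun b : 'I_3 => charN j b) | j <- iota 0 21].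
  by rewrite -val_enum_ord -map_comp.
rewrite (@eq_coef _ _ _ (fun b : 'I_3 => nth 0 [:: 7; 8; 6] b)).
  by rewrite coef_coef3; vm_compute.
move=> b; rewrite -sum1_card big_mkcond /=.
rewrite (eq_bigr (fun i : 'I_21 => if block i == b then 1 else 0)) //.
rewrite -(big_mkord xpredT (fun i => if block i == b then 1 else 0)) unlock.
by case: b => -[|[|[|//]]].
Qed.

From mathcomp Require Import all_order all_algebra.
From mathcomp Require Import all_classical all_reals all_analysis.
From mathcomp Require Import measurable_realfun ring lra.

Import Order.TTheory GRing.Theory Num.Theory.
Import numFieldNormedType.Exports.

Local Open Scope classical_set_scope.
Local Open Scope ring_scope.

(** * A Borsuk-Ulam theorem for products of spheres *)

Section BorsukUlam.
Variables (R : realType) (n : nat) (T : finType) (blk : 'I_n -> T).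

Definition flip (b : T) (w : 'rV[R]_n) : 'rV[R]_n :=
  \row_i (if blk i == b then - w 0 i else w 0 i).

(** The centre of the cell in [-1, 1]^n; consecutive values are 1/M apart. *)
Definition pos M (z : cell n M) : 'rV[R]_n := \row_i ((z i)%:R / M%:R - 1).

Lemma pos_antipode M b (z : cell n M) : (0 < M)%N ->
  pos (antipode blk b z) = flip b (pos z).
Proof.
move=> M0; apply/rowP => i; rewrite !mxE ffunE; case: ifP => // _.
have zM := ltn_ord (z i); rewrite /= subSS natrB; last by rewrite -ltnS.
have -> : M.*2%:R = 2 * M%:R :> R by rewrite -mul2n natrM.
by field; rewrite pnatr_eq0 -lt0n.
Qed.

Lemma pos_at_end M i e (z : cell n M) : (0 < M)%N -> at_end i e z ->
  `|pos z 0 i| = 1.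
Proof.
move=> M0 /eqP zi; rewrite mxE zi /end_pt; case: e {zi}.
  rewrite -mul2n natrM mulfK ?pnatr_eq0 -?lt0n //.
  by rewrite (_ : 2%:R - 1 = 1) ?normr1 //; lra.
by rewrite mul0r sub0r normrN normr1.
Qed.

Lemma pos_touching M (z z' : cell n M) i : (0 < M)%N -> touching z z' ->
  `|pos z 0 i - pos z' 0 i| <= M%:R^-1.
Proof.
move=> M0 /forallP/(_ i); rewrite !mxE => zz.
rewrite (_ : _ - _ = ((z i)%:R - (z' i)%:R) / M%:R); last by ring.
rewrite normrM normfV normr_nat ler_piMl ?invr_ge0 ?ler0n //.
have h1 : (z i)%:R <= (z' i)%:R + 1 :> R by rewrite natr1 ler_nat; lia.
have h2 : (z' i)%:R <= (z i)%:R + 1 :> R by rewrite natr1 ler_nat; lia.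
by rewrite ler_norml; apply/andP; split; lra.
Qed.

Lemma pos_in_cube M (z : cell n M) i : (0 < M)%N -> `|pos z 0 i| <= 1.
Proof.
move=> M0; rewrite mxE ler_norml.
have zM := ltn_ord (z i).
have h : (z i)%:R / M%:R <= 2 :> R.
  rewrite ler_pdivrMr ?ltr0n // -natrM ler_nat; lia.
have h0 : 0 <= (z i)%:R / M%:R :> R by rewrite divr_ge0.
by apply/andP; split; lra.
Qed.

Variables (chi : 'I_n -> T -> bool) (F : 'I_n -> 'rV[R]_n -> R).
Hypothesis F_cts : forall j (u : nat -> 'rV[R]_n) (w : 'rV[R]_n),
  (forall i, u k 0 i @[k --> \oo] --> w 0 i) -> F j (u k) @[k --> \oo] --> F j w.
Hypothesis F_flip : forall j b (w : 'rV[R]_n),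
  (exists2 i, blk i = b & `|w 0 i| = 1) -> F j (flip b w) = (-1) ^+ chi j b * F j w.
Hypothesis chi_coef :
  coef [seq chi j | j <- enum 'I_n] (fun b => #|[pred i | blk i == b]|).

(** The combinatorial theorem is applied to the signs of [F j] at cell centres. *)
Lemma close_zero M : odd M -> exists w : 'rV[R]_n, (forall i, `|w 0 i| <= 1) /\
  forall j, exists p q : 'rV[R]_n,
    [/\ forall i, `|p 0 i - w 0 i| <= M%:R^-1,
        forall i, `|q 0 i - w 0 i| <= M%:R^-1, 0 <= F j p & F j q <= 0].
Proof.
move=> oM; have M0 : (0 < M)%N by case: M oM.
have tieP j := @antisym_exists n M oM T blk (chi j).
(* The sign of F j, completed antisymmetrically at its zeros. *)
pose tie j := projT1 (cid (tieP j)).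
have tie_anti j : antisym blk (chi j) (tie j) := projT2 (cid (tieP j)).
pose sg j (z : cell n M) := if 0 < F j (pos z) then true
  else if F j (pos z) < 0 then false else tie j z.
have sg_anti j : antisym blk (chi j) (sg j).
  move=> b z zb; rewrite /sg pos_antipode // F_flip; last first.
    have /existsP[i /andP[/eqP ib /existsP[e ie]]] := zb.
    by exists i => //; exact: pos_at_end ie.
  rewrite tie_anti //; case: (chi j b);
    rewrite ?mul1r ?mulN1r ?oppr_gt0 ?oppr_lt0 ?expr1 ?expr0.
    by rewrite !addbT; case: ltrgtP.
  by rewrite !addbF.
have [|z zP] := @antisym_touching_flips n M oM T blk 'I_n chi sg sg_anti
    (enum 'I_n) (size_enum_ord n).
  rewrite (_ : (fun b => _) = (fun b => #|[pred i | blk i == b]|)) //.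
  by apply/funext => b; apply: eq_card => i; rewrite !inE.
exists (pos z); split => [i|j]; first exact: pos_in_cube.
have [|z1 [z2 [c1 c2]]] := zP j; first by rewrite size_enum_ord.
have -> : nth xpredT [seq sg i | i <- enum 'I_n] j = sg j.
  by rewrite (nth_map j) ?size_enum_ord //; congr sg; exact: nth_ord_enum.
have cl z' i : touching z z' -> `|pos z' 0 i - pos z 0 i| <= M%:R^-1.
  by rewrite distrC; exact: pos_touching.
have ge z' : sg j z' -> 0 <= F j (pos z') by rewrite /sg; case: ltrgtP => // <-; rewrite lexx.
have le z' : ~~ sg j z' -> F j (pos z') <= 0.
  by rewrite /sg; case: ltrgtP => // <-.
case: (boolP (sg j z1)) => s1; case: (boolP (sg j z2)) => s2 // _.
  by exists (pos z1), (pos z2); 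
    split=> [i|i||]; [exact: cl|exact: cl|exact: ge|exact: le].
by exists (pos z2), (pos z1); 
    split=> [i|i||]; [exact: cl|exact: cl|exact: ge|exact: le].
Qed.

(** At a cluster point w of the approximate zeros, [F j w] is a limit both of nonnegative and of
    nonpositive values. *)
Theorem equivariant_zero : exists w : 'rV[R]_n, forall j, F j w = 0.
Proof.
pose M k := k.*2.+1.
have oM k : odd (M k) by rewrite /M /= odd_double.
have /choice[u uP] := fun k => close_zero (oM k).
have cA : compact [set v : 'rV[R]_n | forall i, v ord0 i \in `[-1, 1]].
  apply: (@rV_compact R n (fun=> `[(-1 : R), 1]%classic)) => _; exact: segment_compact.
have [|w [_ wu]] := cA (u @ \oo) (fmap_proper_filter _ _).
  by exists 0 => // k _ i; rewrite in_itv /= -ler_norml; exact: (uP k).1.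
have near_w m : exists k, (m <= k)%N /\ ball w m.+1%:R^-1 (u k).
  have m0 : 0 < m.+1%:R^-1 :> R by rewrite invr_gt0.
  have [|v [[k mk <-] wk]] := wu [set u k | k in [set k | (m <= k)%N]]
      (ball w m.+1%:R^-1) _ (nbhsx_ballx _ _ m0).
    by exists m => // k mk; exists k.
  by exists k.
have cvg_w (p : nat -> 'rV[R]_n) : (forall m i, `|p m 0 i - w 0 i| <= 2 * m.+1%:R^-1) ->
    forall i, p m 0 i @[m --> \oo] --> w 0 i.
  move=> pw i; apply/cvgrPdistC_le => e e0.
  have e2 : 0 < e / 2 by rewrite divr_gt0.
  have [k _ ke] := near_infty_natSinv_lt (PosNum e2).
  exists k => // m /= km; apply: le_trans (pw m i) _.
  have := ke m km; rewrite /= => h; rewrite mulrC -ler_pdivlMr //; exact: ltW.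
exists w => j.
have pq m : exists pq : 'rV[R]_n * 'rV[R]_n,
    [/\ forall i, `|pq.1 0 i - w 0 i| <= 2 * m.+1%:R^-1,
        forall i, `|pq.2 0 i - w 0 i| <= 2 * m.+1%:R^-1, 0 <= F j pq.1 & F j pq.2 <= 0].
  (* The distance is at most 1/(2k+1) + 1/(m+1), and k >= m. *)
  have [k [mk [_ wk]]] := near_w m; have [_ /(_ j)[p [q [pk qk p0 q0]]]] := uP k.
  have h (v : 'rV[R]_n) i : `|v 0 i - u k 0 i| <= (M k)%:R^-1 ->
      `|v 0 i - w 0 i| <= 2 * m.+1%:R^-1.
    move=> vu; rewrite -(subrKA (u k 0 i)); apply: le_trans (ler_normD _ _) _.
    have uw : `|u k 0 i - w 0 i| < m.+1%:R^-1 by rewrite distrC; exact: wk.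
    have Mm : (M k)%:R^-1 <= m.+1%:R^-1 :> R.
      by rewrite lef_pV2 ?posrE ?ltr0n // ler_nat /M; lia.
    by rewrite mulr_natl mulr2n; apply: lerD; [exact: le_trans vu Mm|exact: ltW].
  by exists (p, q); split=> //= i; exact: h.
have {pq} /choice[pq pqP] := pq.
apply/eqP; rewrite eq_le; apply/andP; split.
  have c : F j (pq m).2 @[m --> \oo] --> F j w.
    by apply: F_cts; apply: cvg_w => m i; case: (pqP m).
  by apply: (cvgr_to_le c); apply: nearW => m; case: (pqP m).
have c : F j (pq m).1 @[m --> \oo] --> F j w.
  by apply: F_cts; apply: cvg_w => m i; case: (pqP m).
by apply: (cvgr_to_ge c); apply: nearW => m; case: (pqP m).
Qed.

End BorsukUlam.

(** * Half-space masses and quantiles *)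

Lemma cvg_sumr (R : realType) (I T : Type) (F : set_system T) (r : seq I)
    (P : pred I) (f : I -> T -> R) (a : I -> R) {FF : Filter F} :
  (forall i, P i -> f i x @[x --> F] --> a i) ->
  \sum_(i <- r | P i) f i x @[x --> F] --> \sum_(i <- r | P i) a i.
Proof. by apply: cvg_big; exact: (@add_continuous R). Qed.

Lemma cvg_prodr (R : realType) (I T : Type) (F : set_system T) (r : seq I)
    (P : pred I) (f : I -> T -> R) (a : I -> R) {FF : Filter F} :
  (forall i, P i -> f i x @[x --> F] --> a i) ->
  \prod_(i <- r | P i) f i x @[x --> F] --> \prod_(i <- r | P i) a i.
Proof. by apply: cvg_big; exact: (@mul_continuous R). Qed.

Section Hyperplanes.
Variable R : realType.

Lemma dotrN n (u x : 'rV[R]_n) : dotr (- u) x = - dotr u x.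
Proof. by rewrite /dotr -sumrN; apply: eq_bigr => i _; rewrite mxE mulNr. Qed.

Lemma dotrZ n k (u x : 'rV[R]_n) : dotr (k *: u) x = k * dotr u x.
Proof. by rewrite /dotr mulr_sumr; apply: eq_bigr => i _; rewrite mxE mulrA. Qed.

Lemma dotr0 n (x : 'rV[R]_n) : dotr 0 x = 0.
Proof. by rewrite /dotr big1 // => i _; rewrite mxE mul0r. Qed.

Lemma measurable_dotr n (u : 'rV[R]_n) : measurable_fun setT (dotr u).
Proof.
apply: measurable_sum => i; apply: measurable_funM => //.
exact: measurable_coord.
Qed.

Lemma measurable_hyperplane n (u : 'rV[R]_n) b :
  measurable [set x | dotr u x = b].
Proof.
rewrite -[X in measurable X]setTI.
have -> : [set x | dotr u x = b] = dotr u @^-1` [set b] by [].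
exact: measurable_dotr.
Qed.

Lemma dotr_rV_cons n (u : 'rV[R]_n.+1) p :
  dotr u (rV_cons p) = u 0 0 * p.2 + dotr (\row_i u 0 (lift ord0 i)) p.1.
Proof.
rewrite /dotr big_ord_recl rV_cons0; congr (_ + _).
by apply: eq_bigr => i _; rewrite rV_consS mxE.
Qed.

(** Induction by Fubini: if the first coefficient is nonzero, sections in that variable are points;
    otherwise the set is a lower hyperplane times a line, and 0 times infinity is 0. *)
Lemma lebesgue_hyperplane n (u : 'rV[R]_n) b : u != 0 ->
  lebesgue_rV [set x | dotr u x = b] = 0%E.
Proof.
elim: n u b => [u b|n IH u b u0].
  by rewrite (_ : u = 0) ?eqxx //; apply/rowP => -[].
set u' := \row_i u 0 (lift ord0 i) : 'rV[R]_n.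
rewrite /= /pushforward /=.
have -> : @rV_cons R n @^-1` [set x | dotr u x = b] =
    [set p | u 0 0 * p.2 + dotr u' p.1 = b].
  by apply/seteqP; split=> p /=; rewrite dotr_rV_cons.
have [u00|u00] := eqVneq (u 0 0) 0.
  have u'0 : u' != 0.
    apply: contra_neq u0 => u'0; apply/rowP => i; rewrite mxE.
    have [j ->|-> //] := unliftP ord0 i.
    by have := congr1 (fun v : 'rV__ => v 0 j) u'0; rewrite !mxE.
  have -> : [set p : 'rV[R]_n * measurableTypeR R | u 0 0 * p.2 + dotr u' p.1 = b] =
      [set x | dotr u' x = b] `*` setT.
    by apply/seteqP; split=> [p /=|p /= []]; rewrite u00 mul0r add0r.
  rewrite product_measure1E //; last exact: measurable_hyperplane.
  by have /= -> := IH u' b u'0; rewrite mul0e.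
rewrite /product_measure1.
apply: integral0_eq => x _ /=.
rewrite (_ : xsection _ x = [set (b - dotr u' x) / u 0 0]).
  exact: lebesgue_measure_set1.
apply/seteqP; split=> y; rewrite xsectionE /=.
  by move=> <-; rewrite addrK mulrC mulKf.
by move=> ->; rewrite mulrC divfK // subrK.
Qed.

End Hyperplanes.

(** * Integrals of signs for a mass distribution *)

Section Mass.
Variables (R : realType) (n : nat) (mu : {finite_measure set 'rV[R]_n -> \bar R}).
Hypothesis mu_mass : mass_distribution mu.

(** The disjunction also admits the hyperplane at infinity, u = 0 and b != 0, which is empty. *)
Lemma mass_hyperplane u b : (u != 0) || (b != 0) -> mu [set x | dotr u x = b] = 0%E.
Proof.
have [->|u0 _] := eqVneq u 0.
  move=> /= b0; rewrite (_ : mkset _ = set0) ?measure0 //.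
  by apply/seteqP; split=> x //=; rewrite dotr0 => /esym /eqP; rewrite (negPf b0).
case: mu_mass => -[f fi muE] _.
rewrite muE; last exact: measurable_hyperplane.
apply: null_set_integral; [exact: measurable_hyperplane| |exact: lebesgue_hyperplane].
apply: measurable_funS (measurable_int _ fi) => //.
Qed.

Lemma ae_off_hyperplane u b : (u != 0) || (b != 0) ->
  {ae mu, forall x, dotr u x != b}.
Proof.
move=> ub; exists [set x | dotr u x = b]; split.
- exact: measurable_hyperplane.
- exact: mass_hyperplane.
- by move=> x /= /negP; rewrite negbK => /eqP.
Qed.

Definition mean (f : 'rV[R]_n -> R) : R := \int[mu]_x f x.

Definition bounded_meas (f : 'rV[R]_n -> R) :=
  measurable_fun setT f /\ forall x, `|f x| <= 1.

Definition ae_cvg (f_ : nat -> 'rV[R]_n -> R) (f : 'rV[R]_n -> R) := exists N,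
  [/\ measurable N, mu N = 0%E & forall x, ~ N x -> f_ k x @[k --> \oo] --> f x].

Lemma bounded_integrable f : bounded_meas f -> mu.-integrable setT (EFin \o f).
Proof.
move=> [mf fb]; apply: measurable_bounded_integrable => //.
  exact: fin_num_fun_lty.
exists 1; split=> // M M1 x _; exact: le_trans (fb x) (ltW M1).
Qed.

Lemma mean_cvg f_ f : (forall k, bounded_meas (f_ k)) -> bounded_meas f ->
  ae_cvg f_ f -> mean (f_ k) @[k --> \oo] --> mean f.
Proof.
move=> bf_ bf [N [mN N0 ff]].
have [|||||_ _ H] := @dominated_convergence _ _ _ mu setT measurableT
  (fun k => EFin \o f_ k) (EFin \o f) (cst 1%:E).
- by move=> k; exact: measurable_int (bounded_integrable (bf_ k)).
- exact: measurable_int (bounded_integrable bf).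
- exists N; split => // x; apply: contra_notP => Nx _.
  by apply: cvg_EFin; [exact: nearW|exact: ff].
- by apply: (@bounded_integrable (cst 1)); split=> // x; rewrite normr1.
- by apply: aeW => x k _ /=; rewrite lee_fin; exact: (bf_ k).2.
apply: fine_cvg; move: H; rewrite fineK //.
exact: integrable_fin_num (bounded_integrable bf).
Qed.

Lemma bounded_measM f g : bounded_meas f -> bounded_meas g ->
  bounded_meas (fun x => f x * g x).
Proof.
move=> [mf fb] [mg gb]; split=> [|x]; first exact: measurable_funM.
by rewrite normrM -[1]mulr1 ler_pM.
Qed.

Lemma bounded_meas_cst c : `|c| <= 1 -> bounded_meas (cst c).
Proof. by move=> c1; split. Qed.

Lemma ae_cvgM f_ g_ f g : ae_cvg f_ f -> ae_cvg g_ g ->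
  ae_cvg (fun k x => f_ k x * g_ k x) (fun x => f x * g x).
Proof.
move=> [N [mN N0 ff]] [P [mP P0 gg]]; exists (N `|` P); split.
- exact: measurableU.
- by rewrite null_set_setU.
- by move=> x /not_orP[Nx Px]; apply: cvgM; [exact: ff|exact: gg].
Qed.

Lemma ae_cvg_cst f : ae_cvg (fun=> f) f.
Proof. by exists set0; split=> // x _; exact: cvg_cst. Qed.

Definition side (u : 'rV[R]_n) b x := Num.sg (dotr u x - b).

Lemma sgr_cvg (t_ : nat -> R) t : t != 0 -> t_ k @[k --> \oo] --> t ->
  Num.sg (t_ k) @[k --> \oo] --> Num.sg t.
Proof.
move=> t0 tt; apply: (@cvg_trans _ (Num.sg t @[k --> \oo])); last exact: cvg_cst.
apply: near_eq_cvg; case/orP: (lt_total t0) => t0'.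
  by near=> k; rewrite !ltr0_sg //; near: k; exact: (cvgr_lt _ tt).
by near=> k; rewrite !gtr0_sg //; near: k; exact: (cvgr_gt _ tt).
Unshelve. all: by end_near. Qed.

Lemma bounded_meas_side u b : bounded_meas (side u b).
Proof.
split=> [|x]; last by rewrite /side normr_sg; case: eqP; rewrite ?ler01 ?lexx.
apply: (@measurableT_comp _ _ _ _ _ _ (@Num.sg R)); last first.
  by apply: measurable_funB => //; exact: measurable_dotr.
apply: nondecreasing_measurable => // s t st.
by case: (sgrP s); case: (sgrP t) => //; lra.
Qed.

(** Off the limit hyperplane, a null set, the signs are eventually constant. *)
Lemma ae_cvg_side u b (u_ : nat -> 'rV[R]_n) b_ : (u != 0) || (b != 0) ->
  (forall x, dotr (u_ k) x - b_ k @[k --> \oo] --> dotr u x - b) ->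
  ae_cvg (fun k => side (u_ k) (b_ k)) (side u b).
Proof.
move=> ub uu; exists [set x | dotr u x = b]; split.
- exact: measurable_hyperplane.
- exact: mass_hyperplane.
- by move=> x /= /eqP xb; apply: sgr_cvg; rewrite ?subr_eq0.
Qed.

Lemma sideN u b x : side (- u) (- b) x = - side u b x.
Proof. by rewrite /side dotrN -opprD sgrN. Qed.

Lemma meanN f : bounded_meas f -> mean (fun x => - f x) = - mean f.
Proof.
move=> bf; rewrite -[RHS]mulN1r -RintegralZl //; last exact: bounded_integrable.
by congr Rintegral; apply/funext => x; rewrite mulN1r.
Qed.

Lemma mean_sum (s : seq (R * ('rV[R]_n -> R))) :
  (forall i, (i < size s)%N -> bounded_meas (nth (0, cst 0) s i).2) ->
  mu.-integrable setT (EFin \o (fun x => \sum_(p <- s) p.1 * p.2 x)) /\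
  mean (fun x => \sum_(p <- s) p.1 * p.2 x) = \sum_(p <- s) p.1 * mean p.2.
Proof.
elim: s => [|p s IH] bs.
  rewrite big_nil; under eq_fun do rewrite big_nil.
  rewrite /mean Rintegral_cst // mul0r; split=> //.
  by apply: (@bounded_integrable (cst 0)); apply: bounded_meas_cst; rewrite normr0.
have [|IHi IHe] := IH; first by move=> i; exact: (bs i.+1).
have pi := bounded_integrable (bs 0%N isT).
have ppi : mu.-integrable setT (EFin \o (fun x => p.1 * p.2 x)).
  exact: (integrableZl measurableT p.1 pi).
rewrite big_cons; under eq_fun do rewrite big_cons.
split; first exact: (integrableD measurableT ppi IHi).
by rewrite /mean RintegralD // RintegralZl // -IHe.
Qed.

Lemma continuous_dotr (u : 'rV[R]_n) : continuous (dotr u).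
Proof.
move=> x; apply: (@cvg_sumr _ _ _ (nbhs x)) => i _; apply: cvgM; first exact: cvg_cst.
exact: coord_continuous.
Qed.

Lemma dotr_gt0 (u : 'rV[R]_n) : u != 0 -> 0 < dotr u u.
Proof.
move=> u0; have [i ui] : exists i, u 0 i != 0.
  apply/existsP; apply: contraR u0 => /existsPn h; apply/eqP/rowP => i.
  by rewrite mxE; apply/eqP; have := h i; rewrite negbK.
rewrite /dotr (bigD1 i) //= ltr_pwDl //; first by rewrite -expr2 exprn_even_gt0.
by apply: sumr_ge0 => j _; rewrite -expr2 sqr_ge0.
Qed.

(** The open strip between the hyperplanes has positive mass, and the signs differ by 2 on it. *)
Lemma mean_side_lt u b c : u != 0 -> b < c -> mean (side u c) < mean (side u b).
Proof.
move=> u0 bc; pose U := [set x | b < dotr u x < c].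
have oU : open U.
  have -> : U = dotr u @^-1` [set t | b < t < c] by [].
  apply: open_comp; first by move=> x _; exact: continuous_dotr.
  have -> : [set t | b < t < c] = `]b, c[%classic.
    by apply/seteqP; split=> t; rewrite /= in_itv.
  exact: interval_open.
have U0 : U !=set0.
  exists (((b + c) / 2 / dotr u u) *: u).
  have h : dotr u (((b + c) / 2 / dotr u u) *: u) = (b + c) / 2.
    rewrite /dotr; under eq_bigr do rewrite mxE mulrCA.
    by rewrite -mulr_sumr -/(dotr u u) mulrVK // unitfE gt_eqF // dotr_gt0.
  by rewrite /U /= h; apply/andP; split; lra.
have mU := open_measurable_mx oU.
have bU : bounded_meas (\1_U : 'rV[R]_n -> R).
  split; first exact: measurable_indic.
  by move=> x; rewrite indicE; case: (_ \in _); rewrite ?normr1 ?normr0 ?ler01.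
have Ugt0 : 0 < mean \1_U.
  rewrite /mean /Rintegral integral_indic // setIT.
  by rewrite fine_gt0 // mu_mass.2 //= ltey_eq fin_num_measure.
rewrite -subr_gt0; apply: lt_le_trans Ugt0 _.
rewrite -RintegralB //; try exact: bounded_integrable (bounded_meas_side _ _).
apply: le_Rintegral => //.
- exact: bounded_integrable.
- exact: (integrableB measurableT (bounded_integrable (bounded_meas_side u b))
                                   (bounded_integrable (bounded_meas_side u c))).
move=> x _; rewrite indicE /side.
case: (boolP (x \in U)) => [|_].
  by rewrite inE => /andP[h1 h2]; rewrite gtr0_sg ?subr_gt0 // ltr0_sg ?subr_lt0 // /=; lra.
rewrite subr_ge0.
by case: (sgrP (dotr u x - b)); case: (sgrP (dotr u x - c)) => //; lra.
Qed.

Lemma mean_side_le u b c : u != 0 -> b <= c -> mean (side u c) <= mean (side u b).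
Proof. by move=> u0; rewrite le_eqVlt => /predU1P[->//|/(mean_side_lt u0)/ltW]. Qed.

Definition mass : R := fine (mu setT).

Lemma mean_cst c : mean (cst c) = c * mass.
Proof. by rewrite /mean Rintegral_cst. Qed.

Lemma mass_gt0 : 0 < mass.
Proof.
rewrite fine_gt0 // ltey_eq fin_num_measure // andbT.
by apply: mu_mass.2; [exact: openT|exists 0].
Qed.

Lemma mean_side_cvg u b (u_ : nat -> 'rV[R]_n) b_ : (u != 0) || (b != 0) ->
  (forall x, dotr (u_ k) x - b_ k @[k --> \oo] --> dotr u x - b) ->
  mean (side (u_ k) (b_ k)) @[k --> \oo] --> mean (side u b).
Proof.
move=> ub uu; apply: mean_cvg; [move=> k| |exact: ae_cvg_side];
  exact: bounded_meas_side.
Qed.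

Lemma mean_side_shift u b (e : nat -> R) : u != 0 -> e k @[k --> \oo] --> 0 ->
  mean (side u (b + e k)) @[k --> \oo] --> mean (side u b).
Proof.
move=> u0 e0; apply: mean_side_cvg => [|x]; first by rewrite u0.
apply: cvgB; first exact: cvg_cst.
by rewrite -[in X in _ --> X](addr0 b); apply: cvgD => //; exact: cvg_cst.
Qed.

(* For s = 1 or s = -1, the half-spaces exhaust the space. *)
Lemma mean_side_infty u (s : R) : u != 0 -> s * s = 1 ->
  mean (side u (s * k%:R)) @[k --> \oo] --> - s * mass.
Proof.
move=> u0 ss; rewrite -mean_cst; apply: mean_cvg.
- by move=> k; exact: bounded_meas_side.
- apply: bounded_meas_cst; rewrite normrN; have := congr1 Num.norm ss.
  rewrite normrM normr1; nra.
exists set0; split=> // x _; apply: (@cvg_trans _ ((- s) @[k --> \oo])); last exact: cvg_cst.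
apply: near_eq_cvg; near=> k.
have kx : `|dotr u x| < k%:R by near: k; exact: nbhs_infty_gtr.
rewrite /side; have [h1 h2] : dotr u x < k%:R /\ - dotr u x < k%:R.
  by move: kx; rewrite ltr_norml => /andP[]; lra.
have /orP[/eqP ->|/eqP ->] : (s == 1) || (s == -1) by rewrite -sqrf_eq1 expr2 ss.
  by rewrite ltr0_sg //; lra.
by rewrite gtr0_sg //; lra.
Unshelve. all: by end_near. Qed.

(** The offset is the supremum of those with mean at least [r * mass]; approaching it from above and
    from below gives the two inequalities. *)
Lemma quantile_exists u r : u != 0 -> -1 < r < 1 ->
  exists c, mean (side u c) = r * mass.
Proof.
move=> u0 /andP[r1 r2]; have t0 := mass_gt0.
pose E := [set t | r * mass <= mean (side u t)].
have E0 : E !=set0.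
  have NN : -1 * -1 = 1 :> R by rewrite mulrNN mulr1.
  have h : r * mass < - (-1) * mass by rewrite opprK ltr_pM2r.
  have [k _ /(_ k (leqnn k)) hk] := cvgr_gt _ (mean_side_infty u0 NN) _ h.
  by exists (-1 * k%:R); exact: ltW.
have Eub : has_ubound E.
  have h : - 1 * mass < r * mass by rewrite ltr_pM2r.
  have [k _ /(_ k (leqnn k)) hk] := cvgr_lt _ (mean_side_infty u0 (mulr1 1)) _ h.
  exists (1 * k%:R) => t /= Et; rewrite leNgt; apply/negP => kt.
  by have := lt_le_trans hk (le_trans Et (mean_side_le u0 (ltW kt))); rewrite ltxx.
have inv0 : @harmonic R k @[k --> \oo] --> 0 := cvg_harmonic.
exists (sup E); apply/eqP; rewrite eq_le; apply/andP; split.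
  have c : mean (side u (sup E + harmonic k)) @[k --> \oo] --> mean (side u (sup E)).
    exact: mean_side_shift.
  apply: (cvgr_to_le c); apply: nearW => k; rewrite leNgt; apply/negP => /ltW Ek.
  have := ub_le_sup Eub Ek; rewrite leNgt ltrDl /harmonic /=.
  by rewrite invr_gt0 ltr0n.
have Ninv0 : - @harmonic R k @[k --> \oo] --> 0.
  by rewrite -oppr0; apply: cvgN.
have c : mean (side u (sup E - harmonic k)) @[k --> \oo] --> mean (side u (sup E)).
  exact: mean_side_shift.
apply: (cvgr_to_ge c); apply: nearW => k; 
have [|t Et tk] := @sup_adherent R E (harmonic k) _ (conj E0 Eub).
  by rewrite /harmonic /= invr_gt0 ltr0n.
by apply: le_trans Et (mean_side_le u0 (ltW tk)).
Qed.

(** The mass above minus the mass below is the fraction r of the total; the default 0 is taken only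
    if no such offset exists. *)
Definition quantile u r : R := xget 0 [set c | mean (side u c) = r * mass].

Lemma quantileP u r : u != 0 -> -1 < r < 1 ->
  mean (side u (quantile u r)) = r * mass.
Proof.
move=> u0 /(quantile_exists u0) [c cP]; rewrite /quantile.
by apply: (@xgetPex _ 0 [set c | mean (side u c) = r * mass]); exists c.
Qed.

Lemma mean_side_inj u : u != 0 -> injective (fun b => mean (side u b)).
Proof.
move=> u0 b c /= e; case: (ltgtP b c) => // /(mean_side_lt u0); by rewrite e ltxx.
Qed.

Lemma quantileN u r : u != 0 -> -1 < r < 1 -> quantile (- u) (- r) = - quantile u r.
Proof.
move=> u0 r1; apply: (@mean_side_inj (- u)); rewrite ?oppr_eq0 //=.
rewrite quantileP ?oppr_eq0 //; last by rewrite ltrN2 ltrNl andbC.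
rewrite (_ : side _ _ = fun x => - side u (quantile u r) x).
  by rewrite meanN ?quantileP ?mulNr //; exact: bounded_meas_side.
by apply/funext => x; exact: sideN.
Qed.

Lemma quantile_lt u r s : u != 0 -> -1 < r -> s < 1 -> r < s ->
  quantile u s < quantile u r.
Proof.
move=> u0 r1 s1 rs; rewrite ltNge; apply/negP => /(mean_side_le u0).
rewrite !quantileP //; [|lra|lra].
by rewrite ler_pM2r ?mass_gt0 // leNgt rs.
Qed.

(** The means at [quantile u r] plus and minus e lie strictly on either side of the level;
    eventually those for [u_ k] do too, and monotonicity traps the quantile. *)
Lemma quantile_cvg u r (u_ : nat -> 'rV[R]_n) : u != 0 -> (forall k, u_ k != 0) ->
  (forall x, dotr (u_ k) x @[k --> \oo] --> dotr u x) -> -1 < r < 1 ->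
  quantile (u_ k) r @[k --> \oo] --> quantile u r.
Proof.
move=> u0 u_0 uu r1; apply/cvgrPdist_lt => e e0.
have c t : mean (side (u_ k) t) @[k --> \oo] --> mean (side u t).
  by apply: mean_side_cvg => [|x]; [rewrite u0|apply: cvgB => //; exact: cvg_cst].
near=> k; rewrite ltr_norml; apply/andP; split.
  have : mean (side (u_ k) (quantile u r + e)) < mean (side u (quantile u r)).
    by near: k; apply: (cvgr_lt _ (c _)); apply: mean_side_lt => //; rewrite ltrDl.
  rewrite quantileP // -(quantileP (u_0 k) r1) => h.
  rewrite ltrBrDl addrC -ltrBrDl opprK ltNge; apply/negP => /(mean_side_le (u_0 k)).
  by rewrite leNgt h.
have : mean (side (u_ k) (quantile u r - e)) > mean (side u (quantile u r)).
  by near: k; apply: (cvgr_gt _ (c _)); apply: mean_side_lt => //; lra.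
rewrite quantileP // -(quantileP (u_0 k) r1) => h.
rewrite ltrBlDl -ltrBlDr ltNge; apply/negP => /(mean_side_le (u_0 k)).
by rewrite leNgt h.
Unshelve. all: by end_near. Qed.

End Mass.

(** * The test map *)

Section Parametrization.
Variable R : realType.
Implicit Types (w : 'rV[R]_21).

(* The cube [-1, 1]^k maps to R^(k+1) minus 0 by w |-> (w, \prod_i (1 - w_i ^ 2)):
   antipodal points of the boundary have opposite images. *)
Definition bump_prod (b : 'I_3) w : R :=
  \prod_(i | blk i == b) (1 - w 0 i ^+ 2).

Definition slab_normal w : 'rV[R]_8 :=
  \row_i (if (i < 7)%N then w 0 (inord i) else bump_prod (inord 0) w).
Definition normal1 w : 'rV[R]_8 := \row_i w 0 (inord (7 + i)).
Definition offset1 w : R := bump_prod (inord 1) w.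
(** The final 0 keeps these normals in a 7-dimensional subspace, so that they represent an S^6. *)
Definition normal2 w : 'rV[R]_8 :=
  \row_i (if (i < 6)%N then w 0 (inord (15 + i))
          else if (i == 6 :> nat) then bump_prod (inord 2) w else 0).

Lemma blk_inord k : (k < 21)%N -> blk (inord k) = inord (block k).
Proof.
by move=> k21; apply: val_inj; rewrite /= !inordK // block_lt.
Qed.

Lemma inord3_eq i j : (i < 3)%N -> (j < 3)%N ->
  (inord i == inord j :> 'I_3) = (i == j).
Proof. by move=> i3 j3; rewrite -val_eqE /= !inordK. Qed.

Lemma bump_prod0 b w : (forall i, blk i = b -> w 0 i = 0) -> bump_prod b w = 1.
Proof. by move=> w0; apply: big1 => i /eqP /w0 ->; rewrite expr0n subr0. Qed.

Lemma bump_prod_flip b c w : bump_prod b (flip blk c w) = bump_prod b w.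
Proof. by apply: eq_bigr => i _; rewrite mxE; case: ifP; rewrite ?sqrrN. Qed.

Lemma bump_prod_boundary b w :
  (exists2 i, blk i = b & `|w 0 i| = 1) -> bump_prod b w = 0.
Proof.
move=> [i ib wi]; rewrite /bump_prod (bigD1 i) ?ib //=.
by rewrite -(real_normK (num_real _)) wi expr1n subrr mul0r.
Qed.

Lemma slab_normal_neq0 w : slab_normal w != 0.
Proof.
apply/eqP => /rowP w0.
have : bump_prod (inord 0) w = 1.
  apply: bump_prod0 => i; move=> /(congr1 val) /=.
  rewrite inordK // /block; case: ifP => i7; last by case: ifP.
  move=> _; have := w0 (inord i); rewrite !mxE inordK; last by lia.
  by rewrite i7 inord_val.
by have := w0 ord_max; rewrite !mxE /= => ->; lra.
Qed.

Lemma hyperplane1_neq0 w : (normal1 w != 0) || (offset1 w != 0).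
Proof.
rewrite -negb_and; apply/negP => /andP[/eqP/rowP w0 /eqP].
rewrite /offset1 bump_prod0; first by lra.
move=> i /(congr1 val) /=; rewrite inordK // /block.
case: ifP => // i7; case: ifP => // i15 _.
have := w0 (inord (i - 7)); rewrite !mxE inordK; last by lia.
by rewrite subnKC ?inord_val //; lia.
Qed.

Lemma normal2_neq0 w : normal2 w != 0.
Proof.
apply/eqP => /rowP w0.
have : bump_prod (inord 2) w = 1.
  apply: bump_prod0 => i; move=> /(congr1 val) /=.
  rewrite inordK // /block; case: ifP => // i7; case: ifP => // i15 _.
  have i21 := ltn_ord i; have := w0 (inord (i - 15)).
  rewrite !mxE inordK; last by lia.
  have -> : (i - 15 < 6)%N by lia.
  by rewrite subnKC ?inord_val //; lia.
by have := w0 (inord 6); rewrite !mxE inordK //= => ->; lra.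
Qed.

(** On the boundary of block 0 the bump entry is 0, so negating the other entries negates the
    vector. *)
Lemma slab_normal_flip b w : (exists2 i, blk i = b & `|w 0 i| = 1) ->
  slab_normal (flip blk b w) =
  if b == inord 0 then - slab_normal w else slab_normal w.
Proof.
move=> wb; case: eqP => b0; apply/rowP => i; rewrite !mxE ?bump_prod_flip.
  case: ifP => i7; last by rewrite -b0 bump_prod_boundary ?oppr0.
  by rewrite blk_inord ?b0 /block ?i7 ?eqxx //; lia.
case: ifP => // i7; rewrite blk_inord /block ?i7; last by lia.
by rewrite eq_sym; case: eqP.
Qed.

Lemma normal1_flip b w :
  normal1 (flip blk b w) = if b == inord 1 then - normal1 w else normal1 w.
Proof.
have bi (i : 'I_8) : blk (inord (7 + i)) = inord 1.
  have i8 := ltn_ord i; rewrite blk_inord /block; last by lia.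
  by rewrite ltnNge leq_addr /= -[15%N]/(7 + 8)%N ltn_add2l i8.
by case: eqP => b1; apply/rowP => i; rewrite !mxE bi ?b1 ?eqxx // eq_sym; case: eqP.
Qed.

Lemma offset1_flip b w : (exists2 i, blk i = b & `|w 0 i| = 1) ->
  offset1 (flip blk b w) = if b == inord 1 then - offset1 w else offset1 w.
Proof.
move=> wb; rewrite /offset1 bump_prod_flip; case: eqP => // b1.
by rewrite -b1 bump_prod_boundary ?oppr0.
Qed.

Lemma normal2_flip b w : (exists2 i, blk i = b & `|w 0 i| = 1) ->
  normal2 (flip blk b w) = if b == inord 2 then - normal2 w else normal2 w.
Proof.
have bi (i : 'I_8) : (i < 6)%N -> blk (inord (15 + i)) = inord 2.
  move=> i6; rewrite blk_inord /block; last by lia.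
  by rewrite ltnNge (leq_trans _ (leq_addr _ _)) //= ltnNge leq_addr.
move=> wb; case: eqP => b2; apply/rowP => i; rewrite !mxE ?bump_prod_flip.
  case: ifP => i6; first by rewrite bi ?b2 ?eqxx.
  by case: ifP => _; rewrite ?oppr0 // -b2 bump_prod_boundary ?oppr0.
by case: ifP => // i6; rewrite bi // eq_sym; case: eqP.
Qed.

Section Convergence.
Variables (u : nat -> 'rV[R]_21) (w : 'rV[R]_21).
Hypothesis uw : forall i, u k 0 i @[k --> \oo] --> w 0 i.

Lemma bump_prod_cvg b : bump_prod b (u k) @[k --> \oo] --> bump_prod b w.
Proof.
apply: (@cvg_prodr _ _ _ \oo) => i _; apply: cvgB; first exact: cvg_cst.
by rewrite expr2; apply: cvgM.
Qed.

Lemma dotr_cvg n (v_ : nat -> 'rV[R]_n) (v x : 'rV[R]_n) :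
  (forall i, v_ k 0 i @[k --> \oo] --> v 0 i) ->
  dotr (v_ k) x @[k --> \oo] --> dotr v x.
Proof.
move=> vv; apply: (@cvg_sumr _ _ _ \oo) => i _; apply: cvgM => //; exact: cvg_cst.
Qed.

Lemma slab_normal_cvg x :
  dotr (slab_normal (u k)) x @[k --> \oo] --> dotr (slab_normal w) x.
Proof.
apply: dotr_cvg => i; under eq_fun do rewrite mxE; rewrite mxE.
by case: ifP => _; [exact: uw|exact: bump_prod_cvg].
Qed.

Lemma hyperplane1_cvg x : dotr (normal1 (u k)) x - offset1 (u k) @[k --> \oo] -->
  dotr (normal1 w) x - offset1 w.
Proof.
apply: cvgB; last exact: bump_prod_cvg.
by apply: dotr_cvg => i; under eq_fun do rewrite mxE; rewrite mxE; exact: uw.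
Qed.

Lemma normal2_cvg x :
  dotr (normal2 (u k)) x @[k --> \oo] --> dotr (normal2 w) x.
Proof.
apply: dotr_cvg => i; under eq_fun do rewrite mxE; rewrite mxE.
by do ?case: ifP => _; [exact: uw|exact: bump_prod_cvg|exact: cvg_cst].
Qed.

End Convergence.
End Parametrization.

(** * The 21 equations *)

Section TestMap.
Variables (R : realType) (mu : {finite_measure set 'rV[R]_8 -> \bar R}).
Hypothesis mu_mass : mass_distribution mu.

(** Mass above minus mass below, as a fraction of the total, when k of the seven slabs lie below. *)
Definition level (k : nat) : R := 1 - 2 * k%:R / 7.

(* The sign of the side of the k-th of the six slab hyperplanes; with the
   conventions for k = 0 and k = 7, the i-th slab has indicator function
   (step_side a i - step_side a i.+1) / 2. *)
Definition step_side a k : 'rV[R]_8 -> R :=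
  if k == 0%N then cst 1 else
  if (k < 7)%N then side a (quantile mu a (level k)) else cst (-1).

Lemma level_in k : (0 < k < 7)%N -> -1 < level k < 1.
Proof.
move=> /andP[k0 k7]; have h1 : 1 <= k%:R :> R by rewrite ler1n.
have h2 : k%:R <= 6 :> R by rewrite ler_nat.
by rewrite /level; apply/andP; split; lra.
Qed.

Lemma levelN k : (k <= 7)%N -> level (7 - k)%N = - level k.
Proof. by move=> k7; rewrite /level natrB //; field. Qed.

Lemma bounded_step_side a k : bounded_meas (step_side a k).
Proof.
rewrite /step_side; case: ifP => _; first by apply: bounded_meas_cst; rewrite normr1.
case: ifP => _; first exact: bounded_meas_side.
by apply: bounded_meas_cst; rewrite normrN1.
Qed.

Lemma mean_step_side a k : a != 0 -> (k <= 7)%N ->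
  mean mu (step_side a k) = level k * mass mu.
Proof.
move=> a0 k7; rewrite /step_side; case: eqP => [->|/eqP k0].
  by rewrite mean_cst /level mulr0 mul0r subr0.
case: ifP => k6; first by rewrite quantileP // level_in // lt0n k0.
have -> : k = 7 by lia.
rewrite mean_cst /level mulfK ?pnatr_eq0 //; congr (_ * _); lra.
Qed.

(** Reversing [a] turns the k-th cut into the (7 - k)-th with its sides exchanged; the constants at
    0 and 7 obey the same rule. *)
Lemma step_sideN a k : a != 0 -> (k <= 7)%N ->
  step_side (- a) k = (fun x => - step_side a (7 - k)%N x).
Proof.
move=> a0 k7; apply/funext => x; rewrite /step_side.
case: (eqVneq k 0%N) => [->|k0] /=; first by rewrite opprK.
case: (eqVneq k 7) => [->//|k7'].
have -> : (k < 7)%N by lia.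
have -> : (7 - k == 0)%N = false by apply/negP; lia.
have -> : (7 - k < 7)%N by lia.
rewrite -[level k]opprK -levelN // quantileN //; last by apply: level_in; lia.
exact: sideN.
Qed.

Lemma step_side_cvg a (a_ : nat -> 'rV[R]_8) k : a != 0 -> (forall k, a_ k != 0) ->
  (forall x, dotr (a_ k) x @[k --> \oo] --> dotr a x) ->
  ae_cvg mu (fun m => step_side (a_ m) k) (step_side a k).
Proof.
move=> a0 a_0 aa; rewrite /step_side; case: eqP => [_|/eqP k0]; first exact: ae_cvg_cst.
case: ifP => k7; last exact: ae_cvg_cst.
apply: ae_cvg_side => // [|x]; first by rewrite a0.
by apply: cvgB => //; apply: quantile_cvg => //; apply: level_in; rewrite lt0n k0.
Qed.

Definition cut g (w : 'rV[R]_21) : 'rV[R]_8 -> R :=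
  match g with
  | 0 => side (normal1 w) (offset1 w)
  | 1 => side (normal2 w) 0
  | _ => fun x => side (normal1 w) (offset1 w) x * side (normal2 w) 0 x
  end.

Definition moment w k g :=
  mean mu (fun x => step_side (slab_normal w) k x * cut g w x).

(** In [test_map], e < 4 gives the difference of the moments at k = e and 7 - k, even in the
    direction; e = 4, 5, 6 gives the sum for k = e - 3, which is odd. The sum for k = 0 is
    identically zero, which leaves 4 + 3 equations. *)
Definition shift e := if (e < 4)%N then e else (e - 3)%N.

Definition test_map (j : 'I_21) w :=
  moment w (shift (j %% 7)) (j %/ 7) -
  (-1) ^+ (4 <= j %% 7)%N * moment w (7 - shift (j %% 7))%N (j %/ 7).

Lemma bounded_cut g w : bounded_meas (cut g w).
Proof.
by case: g => [|[|g]]; try apply: bounded_measM; exact: bounded_meas_side.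
Qed.

Lemma moment_cvg (u : nat -> 'rV[R]_21) (w : 'rV[R]_21) k g :
  (forall i, u m 0 i @[m --> \oo] --> w 0 i) ->
  moment (u m) k g @[m --> \oo] --> moment w k g.
Proof.
move=> uw; apply: mean_cvg => [m||]; 
  try exact: bounded_measM (bounded_step_side _ _) (bounded_cut _ _).
apply: ae_cvgM.
  apply: step_side_cvg => [|m|x]; try exact: slab_normal_neq0.
  exact: slab_normal_cvg.
have c1 : ae_cvg mu (cut 0 \o u) (cut 0 w).
  apply: ae_cvg_side => // [|x]; first exact: hyperplane1_neq0.
  exact: hyperplane1_cvg.
have c2 : ae_cvg mu (cut 1 \o u) (cut 1 w).
  apply: ae_cvg_side => // [|x]; first by rewrite normal2_neq0.
  by apply: cvgB; [exact: normal2_cvg|exact: cvg_cst].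
by case: g => [|[|g]] //; exact: ae_cvgM.
Qed.

Lemma cut_flip g b (w : 'rV[R]_21) :
  (exists2 i, blk i = b & `|w 0 i| = 1) -> (g < 3)%N ->
  cut g (flip blk b w) = (fun x => (-1) ^+ ((b == inord 1) && (g != 1)%N ||
    (b == inord 2) && (g != 0)%N) * cut g w x).
Proof.
move=> wb g3; apply/funext => x.
have e1 : cut 0 (flip blk b w) x = (-1) ^+ (b == inord 1) * cut 0 w x.
  rewrite /cut normal1_flip offset1_flip //; case: eqP => _.
    by rewrite sideN expr1 mulN1r.
  by rewrite expr0 mul1r.
have e2 : cut 1 (flip blk b w) x = (-1) ^+ (b == inord 2) * cut 1 w x.
  rewrite /cut normal2_flip //; case: eqP => _.
    by rewrite -[in LHS]oppr0 sideN expr1 mulN1r.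
  by rewrite expr0 mul1r.
have ne : (b == inord 1) && (b == inord 2) = false.
  apply/negP => /andP[/eqP -> /eqP/(congr1 val)]; by rewrite /= !inordK.
move: g3 ne; case: g => [|[|[|//]]] _ ne.
- by rewrite e1 andbF orbF andbT.
- by rewrite e2 andbF andbT.
rewrite -[LHS]/(cut 0 (flip blk b w) x * cut 1 (flip blk b w) x) e1 e2 mulrACA.
by move: ne; case: (b == inord 1); case: (b == inord 2) => //= _;
  rewrite ?expr0 ?expr1 ?mulr1 ?mul1r.
Qed.

Lemma moment_flip b (w : 'rV[R]_21) k g :
  (exists2 i, blk i = b & `|w 0 i| = 1) -> (g < 3)%N ->
  (k <= 7)%N ->
  moment (flip blk b w) k g =
  if b == inord 0 then - moment w (7 - k)%N g else
  (-1) ^+ ((b == inord 1) && (g != 1)%N || (b == inord 2) && (g != 0)%N) * moment w k g.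
Proof.
move=> wb g3 k7; 
have bm k' := bounded_measM (bounded_step_side (slab_normal w) k') (bounded_cut g w).
rewrite /moment slab_normal_flip // cut_flip //; case: eqP => b0.
  rewrite step_sideN ?slab_normal_neq0 // -meanN //; congr mean; apply/funext => x.
  by rewrite b0 !inord3_eq //= expr0 mul1r mulNr.
case: (_ || _); rewrite ?expr1 ?expr0 ?mulN1r ?mul1r.
  by rewrite -meanN //; congr mean; apply/funext => x; rewrite mulN1r mulrN.
by congr mean; apply/funext => x; rewrite mul1r.
Qed.

Lemma test_map_flip (j : 'I_21) (b : 'I_3) (w : 'rV[R]_21) :
  (exists2 i, blk i = b & `|w 0 i| = 1) ->
  test_map j (flip blk b w) = (-1) ^+ char j b * test_map j w.
Proof.
move=> wb; have j21 := ltn_ord j.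
have g3 : (j %/ 7 < 3)%N by lia.
have k7 : (shift (j %% 7) <= 7)%N by rewrite /shift; case: ifP; lia.
rewrite /test_map !moment_flip // ?leq_subr // subKn //.
have [->|[->|->]] : b = inord 0 \/ b = inord 1 \/ b = inord 2.
  case: b {wb} => -[|[|[|//]]] h; [left|right; left|right; right];
    by apply: val_inj; rewrite /= inordK.
- rewrite eqxx /char inordK // /charN.
  by case: (4 <= _)%N; rewrite ?expr1 ?expr0; ring.
- rewrite /char !inord3_eq // inordK //= orbF /charN.
  by case: (_ != 1)%N; case: (4 <= _)%N; rewrite ?expr1 ?expr0; ring.
- rewrite /char !inord3_eq // inordK //= /charN.
  by case: (_ != 0)%N; case: (4 <= _)%N; rewrite ?expr1 ?expr0; ring.
Qed.

Lemma moments_zero : exists w : 'rV[R]_21,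
  forall k g, (k <= 7)%N -> (g < 3)%N -> moment w k g = 0.
Proof.
have [||w wP] := @equivariant_zero R 21 'I_3 blk char test_map _ _ char_coef.
- move=> j u w uw; apply: cvgB; first exact: moment_cvg.
  by apply: cvgM; [exact: cvg_cst|exact: moment_cvg].
- by move=> j b w; exact: test_map_flip.
exists w => k g k7 g3.
have idx e : (e < 7)%N -> moment w (shift e) g -
    (-1) ^+ (4 <= e)%N * moment w (7 - shift e)%N g = 0.
  move=> e7; have lt21 : (g * 7 + e < 21)%N by lia.
  have := wP (Ordinal lt21); rewrite /test_map /= modnMDl divnMDl // modn_small //.
  by rewrite divn_small // addn0.
(* Both the sum and the difference of the two moments vanish. *)
have both k' : (0 < k' < 4)%N -> moment w k' g = 0 /\ moment w (7 - k')%N g = 0.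
  move=> k4; have := idx k'; have := idx (k' + 3)%N; rewrite /shift.
  have -> : (k' < 4)%N by lia.
  have -> : (k' + 3 < 4)%N = false by apply/negP; lia.
  have -> : (3 < k')%N = false by apply/negP; lia.
  have -> : (3 < k' + 3)%N by lia.
  rewrite addnK expr0 expr1 => h1 h2.
  have {}h1 := h1 ltac:(lia); have {}h2 := h2 ltac:(lia).
  by split; lra.
have m7 : moment w 7 g = - moment w 0 g.
  rewrite /moment -meanN; last exact: bounded_measM (bounded_step_side _ _) (bounded_cut _ _).
  by congr mean; apply/funext => x; rewrite /step_side /= mulN1r mul1r.
have m0 : moment w 0 g = 0.
  by have := idx 0%N isT; rewrite /shift /= expr0 m7; lra.
have [->//|k0] := eqVneq k 0%N.
have [->|k7'] := eqVneq k 7; first by rewrite m7 m0 oppr0.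
have [k4|k4] := ltnP k 4; first by apply: (both k _).1; lia.
have -> : k = (7 - (7 - k))%N by lia.
by apply: (both (7 - k)%N _).2; lia.
Qed.

End TestMap.

(** * Measures of the boxes *)

Section Boxes.
Variables (R : realType) (n : nat).
Implicit Types (u v a x : 'rV[R]_n).

Definition box k a (c : 'I_k -> R) u b v d i s t :=
  slab a c i `&` halfspace u b s `&` halfspace v d t.

Lemma measurable_halfspace u b s : measurable (halfspace u b s).
Proof.
rewrite -[X in measurable X]setTI; case: s.
  have -> : halfspace u b true = dotr u @^-1` [set` `[b, +oo[].
    by apply/seteqP; split=> x; rewrite /= in_itv /= andbT.
  exact: measurable_dotr.
have -> : halfspace u b false = dotr u @^-1` [set` `]-oo, b]].
  by apply/seteqP; split=> x; rewrite /= in_itv.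
exact: measurable_dotr.
Qed.

Lemma measurable_slab k a (c : 'I_k -> R) i : measurable (slab a c i).
Proof.
rewrite (_ : slab a c i = \bigcap_(j in [set: 'I_k]) halfspace a (c j) (j < i)%N).
  by apply: fin_bigcap_measurable => // j _; exact: measurable_halfspace.
apply/seteqP; split=> [x xs j _|x xs j].
  by have := xs j; rewrite /halfspace; case: ifP.
by have := xs j I; rewrite /halfspace; case: ifP.
Qed.

Lemma measurable_box k a (c : 'I_k -> R) u b v d i s t :
  measurable (box a c u b v d i s t).
Proof.
apply: measurableI; last exact: measurable_halfspace.
by apply: measurableI; [exact: measurable_slab|exact: measurable_halfspace].
Qed.

Definition sign_of (s : bool) : R := if s then 1 else -1.

Lemma halfspace_indic u b s x : dotr u x != b ->
  \1_(halfspace u b s) x = (1 + sign_of s * side u b x) / 2 :> R.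
Proof.
rewrite indicE /side /halfspace /sign_of => ub; case: (ltgtP (dotr u x) b) ub => // h _.
  rewrite ltr0_sg ?subr_lt0 //; case: s.
    by rewrite memNset /=; [lra|move=> /=; lra].
  by rewrite mem_set /=; [lra|exact: ltW].
rewrite gtr0_sg ?subr_gt0 //; case: s.
  by rewrite mem_set /=; [lra|exact: ltW].
by rewrite memNset /=; [lra|move=> /=; lra].
Qed.

End Boxes.

(** * Equal masses and non-parallel cuts *)

Section Equipartition.
Variables (R : realType) (mu : {finite_measure set 'rV[R]_8 -> \bar R}).
Hypothesis mu_mass : mass_distribution mu.
Variable (a : 'rV[R]_8).
Hypothesis a0 : a != 0.

Definition cutpoint (j : 'I_6) : R := quantile mu a (level R j.+1).

Lemma cutpoint_lt (j k : 'I_6) : (j < k)%N -> cutpoint j < cutpoint k.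
Proof.
move=> jk; have := ltn_ord k => k6.
have /andP[h1 _] : -1 < level R k.+1 < 1 by apply: level_in.
have /andP[_ h2] : -1 < level R j.+1 < 1 by apply: level_in; rewrite !ltnS; lia.
apply: quantile_lt => //; rewrite /level.
have : (j.+1)%:R < (k.+1)%:R :> R by rewrite ltr_nat ltnS.
lra.
Qed.

Lemma cutpoint_le (j k : 'I_6) : (j <= k)%N -> cutpoint j <= cutpoint k.
Proof.
rewrite leq_eqVlt => /orP[/eqP/val_inj -> //|/cutpoint_lt/ltW //].
Qed.

Lemma step_side_cut (j : 'I_6) x :
  step_side mu a j.+1 x = Num.sg (dotr a x - cutpoint j).
Proof. by rewrite /step_side /= ltnS ltn_ord. Qed.

(** The signs decrease in k from 1 to -1, and x lies in the slab where they drop. *)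
Lemma slab_indic (i : 'I_7) x : (forall j, dotr a x != cutpoint j) ->
  \1_(slab a cutpoint i) x =
    (step_side mu a i x - step_side mu a i.+1 x) / 2 :> R.
Proof.
move=> xc; have i7 := ltn_ord i; rewrite indicE.
have pos j : cutpoint j < dotr a x -> step_side mu a j.+1 x = 1.
  by move=> h; rewrite step_side_cut gtr0_sg ?subr_gt0.
have neg j : dotr a x < cutpoint j -> step_side mu a j.+1 x = -1.
  by move=> h; rewrite step_side_cut ltr0_sg ?subr_lt0.
have lo : i = 0%N :> nat \/ exists2 j : 'I_6, (i = j.+1 :> nat) & (j < i)%N.
  case: (posnP i) => [|i0]; [by left|right].
  have i6 : (i.-1 < 6)%N by lia.
  by exists (Ordinal i6) => /=; lia.
have hi : i = 6 :> nat \/ exists j : 'I_6, i = j :> nat.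
  case: (eqVneq (i : nat) 6) => [|ne]; [by left|right].
  have i6 : (i < 6)%N by lia.
  by exists (Ordinal i6).
have first1 y : step_side mu a 0 y = 1 by [].
have last1 y : step_side mu a 7 y = -1 by [].
case: (boolP (x \in slab a cutpoint i)) => [|xi].
  rewrite inE => xs.
  have -> : step_side mu a i x = 1.
    case: lo => [-> //|[j ij ji]]; rewrite ij pos // lt_neqAle eq_sym xc /=.
    by have := xs j; rewrite ji.
  have -> : step_side mu a i.+1 x = -1.
    case: hi => [-> //|[j ij]]; rewrite ij neg // lt_neqAle xc /=.
    by have := xs j; rewrite ij ltnn.
  by rewrite /=; lra.
have [j /negP] : exists j : 'I_6, ~ (if (j < i)%N then cutpoint j <= dotr a x
    else dotr a x <= cutpoint j).
  by apply/existsNP => xs; move/negP: xi; apply; rewrite inE.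
(* Here x lies beyond a cut, away from the slab; since the cutpoints increase, the two signs
   agree. *)
case: ifP => ji; rewrite -ltNge => xj.
  have -> : step_side mu a i x = -1.
    case: lo => [i0|[k ik ki]]; first by rewrite i0 in ji.
    rewrite ik neg //; apply: lt_le_trans xj (cutpoint_le _).
    by rewrite ik ltnS in ji.
  have -> : step_side mu a i.+1 x = -1.
    case: hi => [-> //|[k ik]]; rewrite ik neg //; apply: lt_le_trans xj (cutpoint_le _).
    by rewrite ik in ji; exact: ltnW.
  by rewrite subrr mul0r.
have -> : step_side mu a i x = 1.
  case: lo => [-> //|[k ik ki]].
  rewrite ik pos //; apply: le_lt_trans (cutpoint_le _) xj.
  by move: ji; rewrite ik ltnS; lia.
have -> : step_side mu a i.+1 x = 1.
  case: hi => [i6|[k ik]]; first by have := ltn_ord j; rewrite i6 in ji; lia.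
  rewrite ik pos //; apply: le_lt_trans (cutpoint_le _) xj.
  by rewrite -ik; lia.
by rewrite subrr mul0r.
Qed.

Variables (u v : 'rV[R]_8) (b d : R).
Hypotheses (u0 : u != 0) (v0 : v != 0).
Let su := side u b.
Let sv := side v d.
Let tk k := step_side mu a k.
Hypothesis su0 : forall k, (k <= 7)%N -> mean mu (fun x => tk k x * su x) = 0.
Hypothesis sv0 : forall k, (k <= 7)%N -> mean mu (fun x => tk k x * sv x) = 0.
Hypothesis suv0 : forall k, (k <= 7)%N ->
  mean mu (fun x => tk k x * (su x * sv x)) = 0.

(** All terms containing a cut integrate to 0; there remains (level i - level (i + 1)) / 8 = (2/7) /
    8 = 1/28 of the mass. *)
Lemma mu_box i s t : mu (box a cutpoint u b v d i s t) = ((28%:R^-1 : R)%:E * mu setT)%E.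
Proof.
have i7 := ltn_ord i; set B := box _ _ _ _ _ _ _ _ _.
have mB : measurable B by exact: measurable_box.
set e := sign_of R s; set f := sign_of R t.
(* The expansion of the product of the three indicator functions. *)
pose l := [:: (8^-1, tk i); (- 8^-1, tk i.+1);
  (e / 8, fun x => tk i x * su x); (- (e / 8), fun x => tk i.+1 x * su x);
  (f / 8, fun x => tk i x * sv x); (- (f / 8), fun x => tk i.+1 x * sv x);
  (e * f / 8, fun x => tk i x * (su x * sv x));
  (- (e * f / 8), fun x => tk i.+1 x * (su x * sv x))].
pose g x := \sum_(p <- l) p.1 * p.2 x.
have bt k := bounded_step_side mu a k.
have bu := bounded_meas_side u b.
have bv := bounded_meas_side v d.
have [|ig gE] := mean_sum mu (s := l).
  by do 8?[case=> [_|]] => //; do ?[exact: bt|exact: bounded_measM|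
    apply: bounded_measM => //; exact: bounded_measM].
have {gE} mg : mean mu g = mass mu / 28.
  rewrite gE /l !big_cons big_nil /= !su0 ?sv0 ?suv0 //; try lia.
  rewrite !mean_step_side //; try lia.
  by rewrite /level -natr1; field.
have -> : mu B = (mean mu g)%:E.
  have bB : bounded_meas (\1_B : 'rV[R]_8 -> R).
    split; first exact: measurable_indic.
    by move=> x; rewrite indicE; case: (_ \in _); rewrite ?normr1 ?normr0 ?ler01.
  have -> : mean mu g = mean mu \1_B.
    rewrite /mean /Rintegral; congr fine; apply: ae_eq_integral => //.
    - exact: measurable_int ig.
    - by apply/measurable_EFinP; exact: bB.1.
    have ha j : {ae mu, forall x, dotr a x != cutpoint j}.
      by apply: ae_off_hyperplane; rewrite ?a0.
    have hu : {ae mu, forall x, dotr u x != b} by apply: ae_off_hyperplane; rewrite ?u0.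
    have hv : {ae mu, forall x, dotr v x != d} by apply: ae_off_hyperplane; rewrite ?v0.
    have {}ha : {ae mu, forall x, forall j, dotr a x != cutpoint j}.
      exact: filter_forall.
    apply: filterS3 ha hu hv => x xc xu xv _ /=.
    rewrite /B /box !indicI /= slab_indic // !halfspace_indic // /g /l !big_cons big_nil /=.
    by rewrite -/e -/f -/su -/sv -!/(tk _); congr EFin; field.
  rewrite /mean /Rintegral fineK; last exact: integrable_fin_num (bounded_integrable mu bB).
  by rewrite integral_indic // setIT.
rewrite mg mulrC EFinM /mass fineK //; exact: fin_num_measure.
Qed.

(** A box has positive mass, so no null set contains it. *)
Lemma box_meets i s t (N : set 'rV[R]_8) : measurable N -> mu N = 0%E ->
  exists2 x, box a cutpoint u b v d i s t x & ~ N x.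
Proof.
move=> mN N0; apply: contrapT => h.
have : (mu (box a cutpoint u b v d i s t) <= mu N)%E.
  apply: le_measure; rewrite ?inE //; first exact: measurable_box.
  by move=> x bx; apply: contrapT => Nx; apply: h; exists x.
rewrite N0 mu_box leNgt; move/negP; apply.
rewrite mule_gt0 // ?lte_fin ?invr_gt0 //.
by apply: mu_mass.2; [exact: openT|exists 0].
Qed.

Lemma box_nonempty i s t : box a cutpoint u b v d i s t !=set0.
Proof.
by have [x xb _] := box_meets i s t measurable0 (measure0 mu); exists x.
Qed.

(** If u = k a, the side of u is monotone along a; points of the first and the last slab, on sides
    chosen against the sign of k, contradict this. *)
Lemma not_parallel_slab : ~ parallel a u.
Proof.
move=> [k uk].
have k0 : k != 0 by apply: contra_neq u0 => k0; rewrite uk k0 scale0r.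
have lt05 : cutpoint ord0 < cutpoint ord_max by apply: cutpoint_lt.
have corner s : exists y z, [/\ y <= cutpoint ord0, cutpoint ord_max <= z,
    if s then b <= k * y else k * y <= b & if s then k * z <= b else b <= k * z].
  have [x [[xs xu] _]] := box_nonempty ord0 s true.
  have [y [[ys yu] _]] := box_nonempty ord_max (~~ s) true.
  exists (dotr a x), (dotr a y).
  have := xs ord0; have := ys ord_max; rewrite /= => h1 h2; split=> //.
    by move: xu; rewrite /halfspace uk /=; case: (s); rewrite /= dotrZ.
  by move: yu; rewrite /halfspace uk /=; case: (s); rewrite /= dotrZ.
have [kpos|kneg|k0'] := ltgtP 0 k; last by rewrite -k0' eqxx in k0.
  have [y [z [h1 h2 h3 h4]]] := corner true.
  have yz : y < z := le_lt_trans h1 (lt_le_trans lt05 h2).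
  by move: yz; rewrite -(ltr_pM2l kpos) ltNge (le_trans h4 h3).
have [y [z [h1 h2 h3 h4]]] := corner false.
have yz : y < z := le_lt_trans h1 (lt_le_trans lt05 h2).
by move: yz; rewrite -(ltr_nM2l kneg) ltNge (le_trans h3 h4).
Qed.

(** If v = k u, consider two boxes opposite in both cuts, chosen by the sign of k: a point of one
    forces the other into the null hyperplane of u. *)
Lemma not_parallel_cuts : ~ parallel u v.
Proof.
move=> [k vk].
have k0 : k != 0 by apply: contra_neq v0 => k0; rewrite vk k0 scale0r.
have mh := measurable_hyperplane u b.
have h0 : mu [set x | dotr u x = b] = 0%E by apply: mass_hyperplane; rewrite ?u0.
have [kpos|kneg|k0'] := ltgtP 0 k; last by rewrite -k0' eqxx in k0.
  have [x [[_ xu] xv] xb] := box_meets ord0 true false mh h0.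
  have [y [[_ yu] yv]] := box_nonempty ord0 false true.
  apply: xb; move: xu xv yu yv; rewrite /halfspace vk /= !dotrZ => xu xv yu yv.
  apply/eqP; rewrite eq_le xu andbT -(ler_pM2l kpos).
  by apply: le_trans xv (le_trans yv _); rewrite ler_pM2l.
have [x [[_ xu] xv] xb] := box_meets ord0 true true mh h0.
have [y [[_ yu] yv]] := box_nonempty ord0 false false.
apply: xb; move: xu xv yu yv; rewrite /halfspace vk /= !dotrZ => xu xv yu yv.
apply/eqP; rewrite eq_le xu andbT -(ler_nM2l kneg).
by apply: le_trans xv; apply: le_trans yv; rewrite ler_nM2l.
Qed.

End Equipartition.

Theorem claim3 (R : realType) (mu : {finite_measure set 'rV[R]_8 -> \bar R})
    (mu_mass : mass_distribution mu) :
  exists (a : 'rV[R]_8) (c : 'I_6 -> R) (u v : 'rV[R]_8) (b d : R),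
    [/\ a != 0, u != 0 & v != 0] /\
    (forall j k : 'I_6, (j < k)%N -> c j < c k) /\
    [/\ ~ parallel a u, ~ parallel a v & ~ parallel u v] /\
    forall (i : 'I_7) (s t : bool),
      mu (slab a c i `&` halfspace u b s `&` halfspace v d t) =
      ((28%:R^-1 : R)%:E * mu setT)%E.
Proof.
have [w wP] := moments_zero mu_mass.
set a := slab_normal w; set u := normal1 w; set b := offset1 w; set v := normal2 w.
have a0 : a != 0 := slab_normal_neq0 w.
have v0 : v != 0 := normal2_neq0 w.
have su0 k (k7 : (k <= 7)%N) :
  mean mu (fun x => step_side mu a k x * side u b x) = 0 :=
  wP k 0%N k7 isT.
have sv0 k (k7 : (k <= 7)%N) :
  mean mu (fun x => step_side mu a k x * side v 0 x) = 0 :=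
  wP k 1%N k7 isT.
have suv0 k (k7 : (k <= 7)%N) :
  mean mu (fun x => step_side mu a k x * (side u b x * side v 0 x)) = 0 :=
  wP k 2%N k7 isT.
(* At infinity the first cut would have constant nonzero sign, and its moment for k = 0 would be
   plus or minus the total mass. *)
have u0 : u != 0.
  apply/eqP => u0; have := hyperplane1_neq0 w; rewrite -/u -/b u0 eqxx /= => b0.
  have := su0 0%N isT.
  rewrite (_ : (fun x => _) = cst (Num.sg (- b))); last first.
    by apply/funext => x; rewrite /step_side /= mul1r /side u0 dotr0 sub0r.
  move/eqP; rewrite mean_cst mulf_eq0 sgr_eq0 oppr_eq0 (negPf b0) /=.
  by rewrite gt_eqF // mass_gt0.
have suv0' k (k7 : (k <= 7)%N) :
  mean mu (fun x => step_side mu a k x * (side v 0 x * side u b x)) = 0.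
  by rewrite -[RHS](suv0 k k7); congr mean; apply/funext => x; rewrite [side v _ _ * _]mulrC.
exists a, (cutpoint mu a), u, v, b, 0; split; first by split.
split; first by move=> j k; exact: cutpoint_lt.
split; last by move=> i s t; exact: (mu_box mu_mass a0 u0 v0 su0 sv0 suv0).
split.
- exact: (not_parallel_slab mu_mass a0 u0 v0 su0 sv0 suv0).
- exact: (not_parallel_slab mu_mass a0 v0 u0 sv0 su0 suv0').
- exact: (not_parallel_cuts mu_mass a0 u0 v0 su0 sv0 suv0).
Qed.
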